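(* Let $\eta>0$, $\eta\neq 1$, and let $u$ be the solution of $$\begin{cases} u_{tt}-u_{xx}=0, & 0<x<\ell(t),\ t>0,\\ (1+\eta\ell'(t))\,u_x(\ell(t),t)+(\eta+\ell'(t))\,u_t(\ell(t),t)=0, & t>0,\\ u(0,t)=0, & t>0,\\ u(x,0)=u^0(x),\quad u_t(x,0)=u^1(x), & 0<x<L,\end{cases}$$ where $|\ell'(t)|<1$ for $t\ge 0$ and $L=\ell(0)$. Then: (i) If the interval is expanding, then $E_\ell(t)$ is nonincreasing for any $\eta>0$. (ii) If the interval is shrinking, then $E_\ell(t)$ is nonincreasing if the damping factor $\eta$ can be taken close enough to the optimal value $\eta=1$.
   Context: Energy: $E_\ell(t):=\frac12\int_0^{\ell(t)}u_t^2(x,t)+u_x^2(x,t)\,dx$ for $t\ge 0$. The interval is $(0,\ell(t))$, considered for $t$ in a time interval $[t_1,t_2]$ with $0\le t_1<t_2$; it is expanding if $0<\ell'(t)<1$ and shrinking if $-1<\ell'(t)<0$ for $t\in[t_1,t_2]$. Standing setting: $\ell\in C([0,+\infty))$ is positive; there is a real-valued $\varphi\in C^1([-L,+\infty))$ with $\varphi'>0$ and $\varphi(t+\ell(t))-\varphi(t-\ell(t))=2$ for all $t\ge 0$; $u^0\in H^1(0,L)$ with $u^0(0)=0$, and $u^1\in L^2(0,L)$. The solution $u$ is the unique one with $u\in C([0,T];V_0(0,\ell(t)))\cap C^1([0,T];L^2(0,\ell(t)))$ for every $T>0$, where $V_0(0,\ell(t)):=\{w\in H^1(0,\ell(t)):w(0)=0\}$.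 The value $\eta=1$ is called optimal because the boundary condition at $x=\ell(t)$ then becomes the transparent (non-reflecting) condition $u_x+u_t=0$. *)

(* Defs.v *)
From HB Require Import structures.
From mathcomp Require Import all_boot all_order all_algebra.
From mathcomp Require Import all_classical all_reals all_analysis.
Set Implicit Arguments.
Unset Strict Implicit.
Unset Printing Implicit Defensive.
Import Order.TTheory GRing.Theory Num.Theory.
Import numFieldNormedType.Exports.
Local Open Scope classical_set_scope.
Local Open Scope ring_scope.

(* Functions of space and time are written [u x t]. *)

Section Calculus.
Context {R : realType}.

(* Derivative relative to [D]: on an interval this is the usual derivative at
   interior points and the one-sided derivative at an endpoint belonging to
   [D]; the values of [f] outside [D] play no role. *)
Definition has_deriv_on (D : set R) (f f' : R -> R) : Prop :=
  forall t, D t -> (f s - f t) / (s - t) @[s --> within D t^'] --> f' t.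

Definition C1_on (D : set R) (f f' : R -> R) : Prop :=
  has_deriv_on D f f' /\ {within D, continuous f'}.

(* [psi] is continuously differentiable on the plane, with partial derivatives
   [psix] and [psit]. *)
Definition C1_plane (psi psix psit : R -> R -> R) : Prop :=
  [/\ forall x t, is_derive x (1 : R) (psi^~ t) (psix x t),
      forall x t, is_derive t (1 : R) (psi x) (psit x t),
      continuous (fun z : R * R => psix z.1 z.2) &
      continuous (fun z : R * R => psit z.1 z.2)].

Definition nonincreasing_on (D : set R) (f : R -> R) : Prop :=
  forall s t, D s -> D t -> s <= t -> f t <= f s.

End Calculus.

Section Spaces.
Context {R : realType}.
Local Notation mu := (@lebesgue_measure R).

(* L^2(D); [f \_ D] is the extension of [f|_D] by zero. *)
Definition L2 (D : set R) (f : R -> R) : Prop :=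
  f \_ D \in Lfun mu 2%:E.

Definition L2norm (D : set R) (f : R -> R) : \bar R :=
  'N[mu]_(2%:E)[EFin \o (f \_ D)].

(* [g] is the weak derivative of [w] on the open interval (a, b); the test
   functions range over C^1_c(a, b). *)
Definition weak_deriv (a b : R) (w g : R -> R) : Prop :=
  forall chi chi' : R -> R,
    C1_on setT chi chi' ->
    (exists c d, [/\ a < c, d < b &
       forall x, x \notin `[c, d] -> chi x = 0]) ->
    \int[mu]_(x in `]a, b[) (w x * chi' x)
      = - \int[mu]_(x in `]a, b[) (g x * chi x).

(* [w] is (the continuous representative on [0, b] of) an element of
   V_0(0, b) = {w in H^1(0, b) : w(0) = 0}, with weak derivative [g]. *)
Definition V0 (b : R) (w g : R -> R) : Prop :=
  [/\ L2 `]0, b[ w, L2 `]0, b[ g, weak_deriv 0 b w g,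
      {within `[0, b], continuous w} & w 0 = 0].

(* t |-> w(., t) is continuous on [0, +oo) with values in the variable space
   L^2(0, l t): all these spaces are seen inside L^2 of the line through
   extension by zero. *)
Definition C0_L2 (l : R -> R) (w : R -> R -> R) : Prop :=
  (forall t, 0 <= t -> L2 `]0, l t[ (w^~ t)) /\
  (forall t, 0 <= t ->
     L2norm setT (fun x => (w^~ s \_ `]0, l s[) x - (w^~ t \_ `]0, l t[) x)
       @[s --> within `[0, +oo[ (nbhs t)] --> 0%E).

(* u is in C([0, T]; V_0(0, l t)) for every T, with space derivative [ux]. *)
Definition C0_V0 (l : R -> R) (u ux : R -> R -> R) : Prop :=
  [/\ forall t, 0 <= t -> V0 (l t) (u^~ t) (ux^~ t),
      C0_L2 l u & C0_L2 l ux].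

(* u is in C^1([0, T]; L^2(0, l t)) for every T, with time derivative [ut].
   The difference quotient of u(., s) and u(., t) only makes sense on the
   common part of the two intervals. *)
Definition C1_L2 (l : R -> R) (u ut : R -> R -> R) : Prop :=
  [/\ C0_L2 l u, C0_L2 l ut &
      forall t, 0 <= t ->
        L2norm `]0, Order.min (l s) (l t)[
            (fun x => (u x s - u x t) / (s - t) - ut x t)
          @[s --> within `[0, +oo[ t^'] --> 0%E].

End Spaces.

Section WaveEquation.
Context {R : realType}.
Local Notation mu := (@lebesgue_measure R).

(* Weak form of
     u_tt - u_xx = 0                                  for 0 < x < l(t), t > 0,
     (1 + eta l') u_x + (eta + l') u_t = 0            at x = l(t), t > 0.
   For smooth u, multiplying the equation by psi with psi(0, .) = 0 and
   integrating by parts on {0 < x < l(t), 0 < t < T} gives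
     [int_0^{l(t)} u_t psi dx]_{t=0}^{t=T}
       = int_0^T int_0^{l(t)} (u_t psi_t - u_x psi_x) dx dt
         + int_0^T (u_x + l' u_t)(l(t), t) psi(l(t), t) dt.
   The boundary condition reads
     u_x + l' u_t = - eta (u_t + l' u_x) = - eta d/dt [u(l(t), t)],
   and integrating the last term by parts in time removes the traces of u_x
   and u_t, which are not defined a priori for a finite-energy solution. *)
Definition weak_wave (eta : R) (l l' : R -> R) (u ux ut : R -> R -> R) : Prop :=
  forall psi psix psit : R -> R -> R,
    C1_plane psi psix psit -> (forall t, psi 0 t = 0) ->
    forall T, 0 <= T ->
    let J t := \int[mu]_(x in `]0, l t[) (ut x t * psi x t)
               + eta * (u (l t) t * psi (l t) t) in
    J T - J 0 =
      \int[mu]_(t in `]0, T[)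
         (\int[mu]_(x in `]0, l t[) (ut x t * psit x t - ux x t * psix x t))
      + eta * \int[mu]_(t in `]0, T[)
         (u (l t) t * (psit (l t) t + l' t * psix (l t) t)).

(* [u] is the finite-energy solution, with derivatives [ux] and [ut], of the
   boundary-damped wave equation with u = 0 at x = 0 and initial data
   (u0, u1). The condition u(0, t) = 0 is part of [C0_V0]. *)
Definition is_solution (eta : R) (l l' u0 u1 : R -> R)
    (u ux ut : R -> R -> R) : Prop :=
  [/\ C0_V0 l u ux, C1_L2 l u ut, weak_wave eta l l' u ux ut,
      {ae mu, forall x, x \in `]0, l 0[ -> u x 0 = u0 x} &
      {ae mu, forall x, x \in `]0, l 0[ -> ut x 0 = u1 x}].

Definition energy (l : R -> R) (ux ut : R -> R -> R) (t : R) : R :=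
  2^-1 * \int[mu]_(x in `]0, l t[) (ut x t ^+ 2 + ux x t ^+ 2).

End WaveEquation.

(* Main.v *)
Require Import Defs.
From HB Require Import structures.
From mathcomp Require Import all_boot all_order all_algebra.
From mathcomp Require Import all_classical all_reals all_analysis.
From mathcomp Require Import measurable_realfun ring lra.
Set Implicit Arguments.
Unset Strict Implicit.
Unset Printing Implicit Defensive.
Import Order.TTheory GRing.Theory Num.Theory.
Import numFieldNormedType.Exports.
Local Open Scope classical_set_scope.
Local Open Scope ring_scope.

(* Extended oddly in x, a solution is a pair of travelling waves: u_t + u_x at
   (x, t) and u_x - u_t at (-x, t) are the values at t + x and t - x of one
   function F, the energy is a quarter of the integral of F^2 over
   [t - l t, t + l t], and the boundary condition says that F leaves the
   interval on the left and re-enters on the right multiplied by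
   g = (eta - 1) / (eta + 1), up to the factor (1 - l') / (1 + l') which comes
   from the motion of the end point.

   For weak solutions this is used in the dual form. The pairing K of (u_t, u_x)
   with (Th (t + x) - Th (t - x), Th (t + x) + Th (t - x)) is conserved as soon
   as Th (t - l t) = g Th (t + l t): the weak formulation gives the derivative
   of the u_t part, and integration by parts in x followed by the
   differentiability of u in L^2 gives that of the u_x part. With
   D t := the integral of Th^2 over [t - l t, t + l t], completing squares gives
   K t <= E t + D t, and K T is as close as we like to E T + D T when Th is a C^1
   approximation of F / 2 at time T. Hence E T <= E S as soon as D S <= D T,
   which holds when g^2 (1 - l') <= 1 + l'. This is automatic if l' > 0, and
   follows from compactness if l' < 0 and eta is close to 1. *)

(** * Square-integrable functions on subsets of the line *)

(** Two constraints shape the weight [Th]. It is prescribed on (T - l T, T + l T) by the final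
    state, and it must obey the reflection rule at all times between S and T. The rule dictates its
    values on (S - l S, T - l T) from those on (S + l S, T + l T), and these two ranges must not
    overlap. They do not when T - l T <= S + l S, hence when T - S is at most the minimum of [l]:
    the inequality is proved for such short steps, each involving a single reflection, and then
    chained. The weight must also be C^1 although its reflected part is cut off at S - l S and T - l
    T. The prescribed part is therefore made to vanish near S + l S and near T + l T, which costs
    arbitrarily little in L^2. The condition on g is the sign of D' = Th (t + l t)^2 ((1 + l') - g^2
    (1 - l')). In the shrinking case g^2 <= (1 + m) / 2 suffices, with m the minimum of [l'],
    because 1 - l' < 2. That this minimum exists with m > -1 rests on the continuity of [l'],
    obtained by differentiating the identity for [phi]. *)

Section L2_theory.
Context {R : realType}.
Local Notation mu := (@lebesgue_measure R).
Local Notation integ D f := (mu.-integrable D (EFin \o f)).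
Implicit Types (D A : set R) (f g h : R -> R).

Lemma integrable_ext D f g : measurable D -> {in D, f =1 g} ->
  integ D f -> integ D g.
Proof. by move=> mD fg; apply: eq_integrable => // x xD /=; rewrite fg. Qed.

Lemma integrableD_EFin D f g : measurable D ->
  integ D f -> integ D g -> integ D (fun x => f x + g x).
Proof. by move=> mD fi gi; apply: (eq_integrable _ _ _ _ (integrableD _ fi gi)). Qed.

Lemma integrableB_EFin D f g : measurable D ->
  integ D f -> integ D g -> integ D (fun x => f x - g x).
Proof. by move=> mD fi gi; apply: (eq_integrable _ _ _ _ (integrableB _ fi gi)). Qed.

Lemma integrableZ_EFin D (a : R) f : measurable D ->
  integ D f -> integ D (fun x => a * f x).
Proof. by move=> mD fi; apply: (eq_integrable _ _ _ _ (integrableZl _ a fi)). Qed.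

Lemma integrable_meas D f : integ D f -> measurable_fun D f.
Proof. by move=> /measurable_int /measurable_EFinP. Qed.

Lemma le_integrable_EFin D f g : measurable D -> measurable_fun D f ->
  (forall x, D x -> `|f x| <= g x) -> integ D g -> integ D f.
Proof.
move=> mD mf fg; apply: le_integrable => //; first exact/measurable_EFinP.
move=> x Dx /=; rewrite lee_fin (le_trans (fg x Dx))//; exact: ler_norm.
Qed.

Lemma L2P D f : measurable D ->
  L2 D f <-> measurable_fun D f /\ integ D (fun x => f x ^+ 2).
Proof.
move=> mD; have sqE : EFin \o (fun x => (f \_ D) x ^+ 2) =
    ((EFin \o (fun x => f x ^+ 2)) \_ D).
  by apply/funext => x; rewrite /= /patch; case: ifP => // _; rewrite expr0n.
split.
- move=> fD; have := fD; rewrite /L2 inE => /andP[+ _]; rewrite inE /= => mf.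
  split; first exact/(measurable_restrictT f mD).
  by have := Lfun2_integrable_sqr fD; rewrite sqE -integrable_mkcond.
- move=> [mf fi]; rewrite /L2 inE /=; apply/andP; split.
    by rewrite inE /=; exact/(measurable_restrictT f mD).
  rewrite inE /= /finite_norm unlock /= poweR_lty//.
  have : mu.-integrable setT (EFin \o (fun x => (f \_ D) x ^+ 2)).
    by rewrite sqE -integrable_mkcond.
  move=> /integrableP[_]; apply: le_lt_trans.
  rewrite le_eqVlt; apply/orP; left; apply/eqP; apply: eq_integral => x _ /=.
  by rewrite powR_mulrn// normrX.
Qed.

Lemma L2_meas D f : measurable D -> L2 D f -> measurable_fun D f.
Proof. by move=> mD /(L2P f mD)[]. Qed.

Lemma L2_sqr D f : measurable D -> L2 D f -> integ D (fun x => f x ^+ 2).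
Proof. by move=> mD /(L2P f mD)[]. Qed.

Lemma L2_mul D f g : measurable D -> L2 D f -> L2 D g ->
  integ D (fun x => f x * g x).
Proof.
move=> mD fD gD.
apply: (@le_integrable_EFin _ _ (fun x => f x ^+ 2 + g x ^+ 2)) => //.
- by apply: measurable_funM; exact: L2_meas.
- move=> x _; rewrite ler_norml; apply/andP; split; nra.
- by apply: integrableD_EFin => //; exact: L2_sqr.
Qed.

Lemma L2D D f g : measurable D -> L2 D f -> L2 D g -> L2 D (fun x => f x + g x).
Proof.
move=> mD fD gD; apply/(L2P _ mD); split.
  by apply: measurable_funD; exact: L2_meas.
apply: (@integrable_ext _ (fun x => (f x ^+ 2 + g x ^+ 2) + 2 * (f x * g x))) => //.
  by move=> x _ /=; ring.
apply: integrableD_EFin => //; last by apply: integrableZ_EFin => //; exact: L2_mul.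
by apply: integrableD_EFin => //; exact: L2_sqr.
Qed.

Lemma L2Z D (a : R) f : measurable D -> L2 D f -> L2 D (fun x => a * f x).
Proof.
move=> mD fD; apply/(L2P _ mD); split.
  by apply: measurable_funM => //; exact: L2_meas.
apply: (@integrable_ext _ (fun x => a ^+ 2 * (f x ^+ 2))) => //.
  by move=> x _ /=; ring.
by apply: integrableZ_EFin => //; exact: L2_sqr.
Qed.

Lemma L2_ext D f g : measurable D -> {in D, f =1 g} -> L2 D f -> L2 D g.
Proof.
move=> mD fg; rewrite /L2 (_ : f \_ D = g \_ D)//.
by apply/funext => x; rewrite /patch; case: ifP => // /fg.
Qed.

Lemma L2B D f g : measurable D -> L2 D f -> L2 D g -> L2 D (fun x => f x - g x).
Proof.
move=> mD fD gD; apply: (@L2_ext _ (fun x => f x + (-1) * g x)) => //.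
  by move=> x _ /=; ring.
by apply: L2D => //; exact: L2Z.
Qed.

Lemma L2S D A f : measurable D -> measurable A -> D `<=` A -> L2 A f -> L2 D f.
Proof.
move=> mD mA DA fA; apply/(L2P _ mD); split.
  exact: (measurable_funS mA DA (L2_meas mA fA)).
by apply: (@integrableS _ _ _ mu A D) => //; exact: L2_sqr.
Qed.

Lemma L2_restrict D f : measurable D -> L2 D f <-> L2 setT (f \_ D).
Proof. by move=> mD; rewrite /L2 patch_setT. Qed.

Lemma bounded_integrable D g (M : R) : measurable D -> (mu D < +oo)%E ->
  measurable_fun D g -> (forall x, D x -> `|g x| <= M) -> integ D g.
Proof.
move=> mD Dy mg gM; apply: (@le_integrable_EFin _ _ (cst M)) => //.
by rewrite (_ : EFin \o cst M = cst M%:E)//; apply/integrableP; split => //=; rewrite integral_cst//; exact: lte_mul_pinfty.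
Qed.

Lemma bounded_L2 D g (M : R) : measurable D -> (mu D < +oo)%E ->
  measurable_fun D g -> (forall x, D x -> `|g x| <= M) -> L2 D g.
Proof.
move=> mD Dy mg gM; apply/(L2P _ mD); split => //.
apply: (@bounded_integrable _ _ (M ^+ 2)) => //; first exact: measurable_funX.
move=> x Dx; rewrite normrX ler_sqr ?nnegrE ?gM//; exact: le_trans (gM x Dx).
Qed.

Lemma L2_integrable D f : measurable D -> (mu D < +oo)%E -> L2 D f -> integ D f.
Proof.
move=> mD Dy fD.
apply: (@integrable_ext _ (fun x => f x * cst 1 x)) => //.
  by move=> x _ /=; rewrite mulr1.
apply: L2_mul => //; apply: (@bounded_L2 _ _ 1) => // x _.
by rewrite /= normr1.
Qed.

Lemma cauchy_schwarz D f g : measurable D -> L2 D f -> L2 D g ->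
  (\int[mu]_(x in D) (f x * g x)) ^+ 2 <=
  \int[mu]_(x in D) (f x ^+ 2) * \int[mu]_(x in D) (g x ^+ 2).
Proof.
move=> mD fD gD; set A := \int[mu]_(x in D) (f x ^+ 2).
set C := \int[mu]_(x in D) (g x ^+ 2); set B := \int[mu]_(x in D) _.
have A0 : 0 <= A by apply: Rintegral_ge0 => x _; exact: sqr_ge0.
have C0 : 0 <= C by apply: Rintegral_ge0 => x _; exact: sqr_ge0.
have fi := L2_sqr mD fD; have gi := L2_sqr mD gD; have fgi := L2_mul mD fD gD.
have key (a : R) : 0 <= A - 2 * a * B + a ^+ 2 * C.
  have -> : A - 2 * a * B + a ^+ 2 * C = \int[mu]_(x in D) ((f x - a * g x) ^+ 2).
    rewrite /A /B /C -!RintegralZl// -RintegralB//; last exact: integrableZ_EFin.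
    rewrite -RintegralD//.
    - by apply: eq_Rintegral => x _; ring.
    - by apply: integrableB_EFin => //; exact: integrableZ_EFin.
    - exact: integrableZ_EFin.
  by apply: Rintegral_ge0 => x _; exact: sqr_ge0.
have [C1|C1] := eqVneq C 0.
  rewrite C1 mulr0; have [->|B1] := eqVneq B 0; first by rewrite expr0n.
  (* With C = 0 the quadratic is affine in a; this value of a would make it equal to -1, so B must
     vanish. *)
  have := key ((A + 1) / (2 * B)).
  rewrite C1 mulr0 addr0 (_ : 2 * _ * B = A + 1); last by field.
  lra.
have Cp : 0 < C by rewrite lt_neqAle eq_sym C1.
have := key (B / C).
rewrite (_ : _ - _ + _ = (A * C - B ^+ 2) / C); last by field.
by rewrite pmulr_lge0 ?invr_gt0// subr_ge0.
Qed.

(** Squaring the bound on the extended-real norm also shows that the integral of h^2 is finite, so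
    passing to the real-valued integral loses nothing. *)
Lemma L2norm_le_int D h (e : R) : 0 <= e -> (L2norm D h <= e%:E)%E ->
  \int[mu]_(x in D) (h x ^+ 2) <= e ^+ 2.
Proof.
move=> e0; rewrite /L2norm unlock /= => he.
have {}he : (\int[mu]_x (`|((h \_ D) x)%:E| `^ 2)%E <= (e ^+ 2)%:E)%E.
  set I := (\int[mu]_x _)%E in he *.
  have I0 : (0 <= I)%E by apply: integral_ge0 => x _; exact: poweR_ge0.
  have -> : I = ((I `^ 2^-1) `^ 2)%E.
    by rewrite -poweRrM ?poweRe1// mulVf// ?poweRe1.
  rewrite (_ : (e ^+ 2)%:E = (e%:E `^ 2)%E); last by rewrite poweR_EFin powR_mulrn.
  by apply: gt0_ler_poweR => //; rewrite in_itv/= ?poweR_ge0 ?leey ?lee_fin ?e0.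
rewrite Rintegral_mkcond.
have E : (\int[mu]_x (((fun x => h x ^+ 2) \_ D) x)%:E =
          \int[mu]_x (`|((h \_ D) x)%:E| `^ 2)%E)%E.
  apply: eq_integral => x _ /=; rewrite powR_mulrn//.
  rewrite real_normK ?num_real// /patch; case: ifP => // _.
  by rewrite expr0n.
rewrite /Rintegral E; set I := (\int[mu]_x _)%E in he *.
have I0 : (0 <= I)%E by apply: integral_ge0 => x _; exact: poweR_ge0.
by rewrite -lee_fin fineK// ge0_fin_numE// (le_lt_trans he)// ltry.
Qed.

(** The domain may vary with s because the difference quotients of u live on the common part of two
    intervals. *)
Lemma L2norm_cvg_int (T : Type) (F : set_system T) (FF : Filter F)
    (D : T -> set R) (h : T -> R -> R) :
  L2norm (D s) (h s) @[s --> F] --> 0%E ->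
  \int[mu]_(x in D s) (h s x ^+ 2) @[s --> F] --> (0 : R).
Proof.
move=> /fine_cvgP[fi hF]; apply/cvgrPdist_le => e e0.
have se : 0 < Num.sqrt e by rewrite sqrtr_gt0.
move/cvgrPdist_le : hF => /(_ _ se) hF; near=> s.
rewrite sub0r normrN ger0_norm; last by apply: Rintegral_ge0 => x _; exact: sqr_ge0.
rewrite -(sqr_sqrtr (ltW e0)); apply: L2norm_le_int; first exact: ltW.
have sf : (L2norm (D s) (h s)) \is a fin_num by near: s.
rewrite -(fineK sf) lee_fin.
have : `|0 - fine (L2norm (D s) (h s))| <= Num.sqrt e by near: s.
by rewrite sub0r normrN; apply: le_trans; exact: ler_norm.
Unshelve. all: by end_near. Qed.

End L2_theory.

(** * Derivatives, the fundamental theorem of calculus and C^1 steps *)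

Section real_calculus.
Context {R : realType}.
Local Notation mu := (@lebesgue_measure R).
Local Notation integ D f := (mu.-integrable D (EFin \o f)).
Implicit Types (f g : R -> R) (t x : R).

Lemma difference_quotient_le (a b h e : R) : h != 0 ->
  (`|a / h - b| <= e) = (`|a - b * h| <= e * `|h|).
Proof.
move=> h0; rewrite -(ler_pM2r (_ : 0 < `|h|)) ?normr_gt0// -normrM mulrBl.
by rewrite divfK.
Qed.

(** The division-free form also makes sense at s = t, so it holds on a full neighbourhood and
    combines easily with other estimates. *)
Lemma is_deriveP f t (a : R) : is_derive t (1 : R) f a <->
  forall e, 0 < e -> \forall s \near t, `|f s - f t - a * (s - t)| <= e * `|s - t|.
Proof.
split=> [[fd <-] e e0|H].
  have /cvgrPdist_le /(_ e e0) : h^-1 *: (f (h + t) - f t) @[h --> (0 : R)^'] --> 'D_1 f t.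
    apply: cvg_trans; last exact: fd.
    by apply: near_eq_cvg; near=> h; rewrite /= /GRing.scale/= mulr1.
  rewrite near_withinE => H; apply/(nbhs0P (fun s => `|f s - f t - _ * (s - t)| <= e * `|s - t|)).
  near=> h; have [->|h0] := eqVneq h 0.
    by rewrite addr0 !subrr mulr0 normr0 subr0 normr0 mulr0.
  have := (near H h); rewrite (addrC t) addrK => /(_ _ h0).
  rewrite distrC /GRing.scale/= mulrC difference_quotient_le//; apply.
  by [].
have C : h^-1 *: (f (h *: 1 + t) - f t) @[h --> (0 : R)^'] --> a.
  apply/cvgrPdist_le => e e0; rewrite near_withinE.
  have /(nbhs0P (fun s => `|f s - f t - _ * (s - t)| <= e * `|s - t|)) := H e e0.
  apply: filterS => h; rewrite (addrC t) addrK => Hh h0.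
  by rewrite distrC /GRing.scale/= mulrC mulr1 difference_quotient_le.
by apply: DeriveDef; [exact: cvgP C|exact: cvg_lim C].
Unshelve. all: by end_near. Qed.

Lemma has_deriv_onP D f f' t : D t -> has_deriv_on D f f' ->
  forall e, 0 < e -> \forall s \near t, D s ->
    `|f s - f t - f' t * (s - t)| <= e * `|s - t|.
Proof.
move=> Dt /(_ t Dt) /cvgrPdist_le H e e0; have := H e e0.
rewrite !near_withinE; apply: filterS => s Hs Ds.
have [->|st] := eqVneq s t; first by rewrite !subrr mulr0 subrr normr0 mulr0.
by rewrite -difference_quotient_le ?subr_eq0// distrC; exact: Hs.
Qed.

Lemma has_deriv_on_is_derive D f f' t : nbhs t D -> has_deriv_on D f f' ->
  is_derive t (1 : R) f (f' t).
Proof.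
move=> Dt fD; apply/is_deriveP => e e0.
have := has_deriv_onP (nbhs_singleton Dt) fD e0.
by apply: filterS2 Dt => s Ds; exact.
Qed.


Lemma within_continuousP D f : {within D, continuous f} <->
  forall t, D t -> forall e, 0 < e -> \forall s \near t, D s -> `|f s - f t| <= e.
Proof.
rewrite subspace_continuousP; split=> H t Dt.
  move=> e e0; have /cvgrPdist_le/(_ e e0) := H t Dt.
  by rewrite near_withinE; apply: filterS => s + Ds; rewrite distrC; exact.
apply/cvgrPdist_le => e e0; rewrite near_withinE.
by apply: filterS (H t Dt e e0) => s + Ds; rewrite distrC; exact.
Qed.

Lemma C1_onTP f f' :
  C1_on setT f f' <-> (forall t, is_derive t (1 : R) f (f' t)) /\ continuous f'.
Proof.
split.
  move=> [fD fc]; split; first by move=> t; apply: has_deriv_on_is_derive fD; exact: filterT.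
  move=> t; apply/cvgrPdist_le => e e0; have /within_continuousP/(_ t I e e0) := fc.
  by apply: filterS => s /(_ I); rewrite distrC.
move=> [fD fc]; split; last exact: continuous_subspaceT.
move=> t _; have /is_deriveP H := fD t.
apply/cvgrPdist_le => e e0; have := H e e0.
rewrite !near_withinE; apply: filterS => s Hs st.
move=> _; rewrite distrC difference_quotient_le// subr_eq0//.
Qed.

Lemma is_derive_continuous f t a : is_derive t (1 : R) f a -> {for t, continuous f}.
Proof. by move=> [fd _]; apply/differentiable_continuous/derivable1_diffP. Qed.

Lemma continuous_integrable_itv f a b : {within `[a, b], continuous f} ->
  integ `[a, b] f.
Proof. by move=> fc; apply: continuous_compact_integrable => //; exact: segment_compact. Qed.

Lemma integrable_itv_oo f a b : integ `[a, b] f -> integ `]a, b[ f.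
Proof.
by apply: integrableS => //; exact: subset_itv_oo_cc.
Qed.

Lemma Rintegral_itv_oo_cc f a b :
  integ `[a, b] f -> \int[mu]_(x in `]a, b[) f x = \int[mu]_(x in `[a, b]) f x.
Proof.
move=> fi; rewrite Rintegral_itv_bndo_bndc; last exact: integrable_itv_oo.
rewrite Rintegral_itv_obnd_cbnd//; apply: integrableS fi => //.
exact: subset_itv_oc_cc.
Qed.

Lemma FTC f f' a b : a <= b -> (forall t, is_derive t (1 : R) f (f' t)) ->
  continuous f' -> \int[mu]_(x in `]a, b[) f' x = f b - f a.
Proof.
rewrite le_eqVlt => /predU1P[->|ab] fD fc.
  by rewrite set_itvoo0 ?Rintegral_set0 ?subrr.
have fcont x : {for x, continuous f} by exact: is_derive_continuous (fD x).
rewrite Rintegral_itv_oo_cc; last first.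
  by apply/continuous_integrable_itv/continuous_subspaceT.
rewrite /Rintegral (continuous_FTC2 (F := f))//.
- exact: continuous_subspaceT.
- split; first by move=> x _; case: (fD x).
    exact/cvg_at_right_filter/fcont.
  exact/cvg_at_left_filter/fcont.
- by move=> x _; rewrite derive1E; case: (fD x).
Qed.

Lemma Rdominated_cvg (D : set R) (f_ : nat -> R -> R) f g : measurable D ->
  (forall n, measurable_fun D (f_ n)) ->
  (forall x, D x -> f_ n x @[n --> \oo] --> f x) -> integ D g ->
  (forall n x, D x -> `|f_ n x| <= g x) ->
  \int[mu]_(x in D) f_ n x @[n --> \oo] --> \int[mu]_(x in D) f x.
Proof.
move=> mD mf ff gi fg.
have gfi n : integ D (f_ n) by apply: le_integrable_EFin gi => //; exact: fg.
have mlim : measurable_fun D f by exact: (measurable_fun_cvg mf ff).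
have fi : integ D f.
  apply: le_integrable_EFin gi => // x Dx.
  have H : `|f_ n x| @[n --> \oo] --> `|f x| by apply: cvg_norm; exact: ff.
  rewrite -(cvg_lim _ H)//; apply: limr_le; first exact: cvgP H.
  by near=> n; exact: fg.
apply: fine_cvg; rewrite fineK; last exact: integrable_fin_num.
suff : (\int[mu]_(x in D) (EFin \o f_ n) x)%E @[n --> \oo] -->
  (\int[mu]_(x in D) (EFin \o f) x)%E by [].
apply: dominated_cvg gi _ => //.
- by move=> n; exact: (measurableT_comp _ (mf n)).
- by move=> x Dx; apply: cvg_EFin; [near=> n|exact: ff].
Unshelve. all: by end_near. Qed.

Lemma is_derive_affine f (a b x d : R) : is_derive (a * x + b) (1 : R) f d ->
  is_derive x (1 : R) (fun y => f (a * y + b)) (d * a).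
Proof.
move=> fd; have g : is_derive x (1 : R) (fun y => a * y + b) a.
  by apply: is_derive_eq; rewrite addr0 /GRing.scale/= mulr1.
by change (is_derive x (1 : R) (f \o (fun y : R => a * y + b)) (d * a)); exact: is_derive1_comp.
Qed.

(** The first-order error is at most (s - t)^2 in each of the four sign cases. This is the
    elementary C^1 function from which all cutoffs are built. *)
Lemma is_derive_sqr_pos t :
  is_derive t (1 : R) (fun x => Num.max x 0 ^+ 2) (2 * Num.max t 0).
Proof.
apply/is_deriveP => e e0; near=> s.
have st : `|s - t| <= e by near: s; apply/nbhs_ballP; exists e => //= s; rewrite /ball/= distrC => /ltW.
apply: (@le_trans _ _ (`|s - t| * `|s - t|)); last by rewrite ler_wpM2r.
rewrite -normrM ger0_norm; last by rewrite -expr2 sqr_ge0.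
have sq := sqr_ge0 (s - t); have sq1 := sqr_ge0 s; have sq2 := sqr_ge0 t.
case: (leP s 0) => s0; case: (leP t 0) => t0; rewrite ler_norml; apply/andP; split.
- nra.
- nra.
- have : 0 <= - s * t by rewrite mulr_ge0 ?oppr_ge0// ltW.
  nra.
- nra.
- nra.
- have : 0 <= s * - t by rewrite mulr_ge0 ?oppr_ge0// ltW.
  nra.
- nra.
- nra.
Unshelve. all: by end_near. Qed.

(* [dstep] is a tent of mass 1 supported in [0, 1], and [step] its primitive. *)
Definition step (x : R) : R :=
  2 * Num.max x 0 ^+ 2 - 4 * Num.max (x - 2^-1) 0 ^+ 2 + 2 * Num.max (x - 1) 0 ^+ 2.

Definition dstep (x : R) : R :=
  4 * Num.max x 0 - 8 * Num.max (x - 2^-1) 0 + 4 * Num.max (x - 1) 0.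

Lemma is_derive_step x : is_derive x (1 : R) step (dstep x).
Proof.
have E c : is_derive x (1:R) (fun y : R => Num.max (y - c) 0 ^+ 2) (2 * Num.max (x - c) 0).
  have := @is_derive_affine (fun z => Num.max z 0 ^+ 2) 1 (- c) x (2 * Num.max (x - c) 0).
  rewrite mul1r mulr1 => /(_ (is_derive_sqr_pos _)).
  by under eq_fun do rewrite mul1r.
have H0 := is_derive_sqr_pos x.
have H1 := is_deriveB (is_deriveZ 2 H0) (is_deriveZ 4 (E 2^-1)).
have := is_deriveD H1 (is_deriveZ 2 (E 1)).
rewrite /GRing.scale /=; congr is_derive; rewrite /dstep; ring.
Qed.

Lemma continuous_dstep : continuous dstep.
Proof.
have M (c : R) : continuous (fun y : R => Num.max (y - c) 0).
  move=> y; apply/cvgrPdist_le => e e0; near=> s.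
  have : `|y - s| <= e by near: s; exact: cvgr_dist_le.
  case: (leP (y - c) 0) => ?; case: (leP (s - c) 0) => ?; rewrite !ler_norml => /andP[? ?]; apply/andP; split; lra.
have M0 : continuous (fun y : R => Num.max y 0).
  by move=> y; have := M 0 y; under eq_fun do rewrite subr0.
move=> x; apply: cvgD; first apply: cvgB.
- by apply: cvgM; [exact: cvg_cst|exact: M0].
- by apply: cvgM; [exact: cvg_cst|exact: M].
- by apply: cvgM; [exact: cvg_cst|exact: M].
Unshelve. all: by end_near. Qed.

Lemma dstep_ge0 x : 0 <= dstep x.
Proof.
rewrite /dstep; case: (lerP x 0) => ?; case: (lerP (x - 2^-1) 0) => ?; case: (lerP (x - 1) 0) => ?; lra.
Qed.

Lemma dstep_out x : (x <= 0) || (1 <= x) -> dstep x = 0.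
Proof.
rewrite /dstep => /orP[] ?; case: (lerP x 0) => ?; case: (lerP (x - 2^-1) 0) => ?; case: (lerP (x - 1) 0) => ?; lra.
Qed.

Lemma step_lo x : x <= 0 -> step x = 0.
Proof.
rewrite /step => ?; case: (lerP x 0) => ?; case: (lerP (x - 2^-1) 0) => ?; case: (lerP (x - 1) 0) => ?; nra.
Qed.

Lemma step_hi x : 1 <= x -> step x = 1.
Proof.
rewrite /step => ?; case: (lerP x 0) => ?; case: (lerP (x - 2^-1) 0) => ?; case: (lerP (x - 1) 0) => ?; nra.
Qed.

Lemma step_ge0_le1 x : 0 <= step x <= 1.
Proof.
rewrite /step; case: (lerP x 0) => ?; case: (lerP (x - 2^-1) 0) => ?; case: (lerP (x - 1) 0) => ?; nra.
Qed.

End real_calculus.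

(** * Integration by parts for weak derivatives *)

Section by_parts.
Context {R : realType}.
Local Notation mu := (@lebesgue_measure R).
Local Notation integ D f := (mu.-integrable D (EFin \o f)).
Implicit Types (f g w h : R -> R) (t x : R).

(** Rises from 0 at c to 1 at c + r; its derivative [dramp] approximates a Dirac mass at c as r
    tends to 0. *)
Definition ramp (c r x : R) : R := step ((x - c) / r).
Definition dramp (c r x : R) : R := dstep ((x - c) / r) / r.

Lemma is_derive_ramp c r x : is_derive x (1 : R) (ramp c r) (dramp c r x).
Proof.
have := @is_derive_affine _ step r^-1 (- c / r) x (dstep ((x - c) / r)).
rewrite (_ : r^-1 * x + - c / r = (x - c) / r); last by ring.
move=> /(_ (is_derive_step _)).
rewrite (_ : (fun y : R => step (r^-1 * y + - c / r)) = ramp c r)//.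
by apply/funext => y; rewrite /ramp; congr step; ring.
Qed.

Lemma continuous_dramp c r : continuous (dramp c r).
Proof.
move=> x; apply: cvgM; last exact: cvg_cst.
apply: (@continuous_comp _ _ _ (fun y : R => (y - c) / r) dstep); last exact: continuous_dstep.
by apply: cvgM; [apply: cvgB => //; exact: cvg_cst|exact: cvg_cst].
Qed.

Lemma dramp_ge0 c r x : 0 < r -> 0 <= dramp c r x.
Proof. by move=> r0; rewrite mulr_ge0 ?dstep_ge0// invr_ge0 ltW. Qed.

Lemma dramp_out c r x : 0 < r -> (x <= c) || (c + r <= x) -> dramp c r x = 0.
Proof.
move=> r0 H; rewrite /dramp dstep_out ?mul0r// ler_pdivrMr// ler_pdivlMr//.
by rewrite mul0r mul1r lerBrDl subr_le0.
Qed.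

Lemma ramp_lo c r x : 0 < r -> x <= c -> ramp c r x = 0.
Proof. by move=> r0 H; rewrite /ramp step_lo// ler_pdivrMr// mul0r subr_le0. Qed.

Lemma ramp_hi c r x : 0 < r -> c + r <= x -> ramp c r x = 1.
Proof. by move=> r0 H; rewrite /ramp step_hi// ler_pdivlMr// mul1r lerBrDl. Qed.

Lemma measurable_itv_continuous h (a b : R) : {within `[a, b], continuous h} ->
  measurable_fun `]a, b[ h.
Proof.
move=> hc; apply: (@measurable_funS _ _ _ _ `[a, b]%classic) => //.
  exact: subset_itv_oo_cc.
exact: subspace_continuous_measurable_fun.
Qed.

Lemma continuous_itv_bounded h (a b : R) : {within `[a, b], continuous h} ->
  exists2 M, 0 <= M & forall x, x \in `[a, b] -> `|h x| <= M.
Proof.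
move=> hc; have [ab|ba] := leP a b; last first.
  exists 0 => // x; rewrite in_itv/= => /andP[ax xb].
  by have := le_trans ax xb; rewrite leNgt ba.
have nc : {within `[a, b], continuous (fun x => `|h x|)}.
  by move=> x; apply: continuous_comp; [exact: hc|exact: norm_continuous].
have [c _ Hc] := EVT_max ab nc.
by exists `|h c| => // x /Hc.
Qed.

Lemma lty_itv (a b : R) : (mu `]a, b[%classic < +oo)%E.
Proof. by rewrite lebesgue_measure_itv /=; case: ifP => // _; rewrite ltry. Qed.

Lemma continuous_itv_integrable h (a b : R) : {within `[a, b], continuous h} ->
  integ `]a, b[ h.
Proof. by move=> /continuous_integrable_itv; exact: integrable_itv_oo. Qed.

Lemma continuous_itv_L2 h (a b : R) : {within `[a, b], continuous h} ->
  L2 `]a, b[ h.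
Proof.
move=> hc; have [M _ HM] := continuous_itv_bounded hc.
apply: (@bounded_L2 _ _ _ M) => //; first exact: lty_itv.
  exact: measurable_itv_continuous.
by move=> x xab; apply: HM; exact: subset_itv_oo_cc xab.
Qed.

Lemma within_continuousM D f g : {within D, continuous f} ->
  {within D, continuous g} -> {within D, continuous (fun x => f x * g x)}.
Proof. by move=> fc gc x; apply: cvgM; [exact: fc|exact: gc]. Qed.

(** The kernel [dramp c r] is nonnegative, has mass 1 and lives on [c, c + r], so the integral is an
    average of h over that interval. *)
Lemma dramp_localizes h (b c r h0 e : R) : 0 < r -> 0 <= c -> c + r <= b ->
  {within `[0, b], continuous h} ->
  (forall x, c <= x <= c + r -> `|h x - h0| <= e) ->
  `|\int[mu]_(x in `]0, b[) (h x * dramp c r x) - h0| <= e.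
Proof.
move=> r0 c0 crb hc he.
have b0 : 0 <= b by lra.
have k1 : \int[mu]_(x in `]0, b[) dramp c r x = 1.
  rewrite (FTC b0 (is_derive_ramp c r) (@continuous_dramp c r)).
  by rewrite ramp_hi// ramp_lo// subr0.
have kc : {within `[0, b], continuous (dramp c r)}.
  by apply: continuous_subspaceT; exact: continuous_dramp.
have ki := continuous_itv_integrable kc.
have hki := continuous_itv_integrable (within_continuousM hc kc).
have -> : \int[mu]_(x in `]0, b[) (h x * dramp c r x) - h0 =
    \int[mu]_(x in `]0, b[) ((h x - h0) * dramp c r x).
  rewrite -{1}(mulr1 h0) -k1 -RintegralZl// -RintegralB//; last exact: integrableZ_EFin.
  by apply: eq_Rintegral => x _; ring.
have di : integ `]0, b[ (fun x => (h x - h0) * dramp c r x).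
  apply: (@integrable_ext _ _ (fun x => h x * dramp c r x - h0 * dramp c r x)) => //.
    by move=> x _ /=; ring.
  by apply: integrableB_EFin => //; exact: integrableZ_EFin.
apply: (le_trans (le_normr_Rintegral _ di)) => //.
rewrite -(mulr1 e) -k1 -RintegralZl//; apply: le_Rintegral => //.
- by apply: integrable_norm.
- exact: integrableZ_EFin.
move=> x _; rewrite normrM (ger0_norm (dramp_ge0 _ _ r0)).
have [xc|cx] := leP x c; first by rewrite dramp_out ?xc// !mulr0.
have [xr|rx] := leP (c + r) x; first by rewrite dramp_out ?xr ?orbT// !mulr0.
by rewrite ler_wpM2r ?dramp_ge0// he// !ltW.
Qed.

(** A cutoff supported in [r, b - r]: [weak_deriv] only accepts test functions that vanish near both
    end points, and a general chi is multiplied by this one. *)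
Definition plateau (b r x : R) : R := ramp r r x - ramp (b - 2 * r) r x.
Definition dplateau (b r x : R) : R := dramp r r x - dramp (b - 2 * r) r x.

Lemma is_derive_plateau b r x : is_derive x (1 : R) (plateau b r) (dplateau b r x).
Proof. exact: is_deriveB (is_derive_ramp _ _ _) (is_derive_ramp _ _ _). Qed.

Lemma continuous_dplateau b r : continuous (dplateau b r).
Proof. by move=> x; apply: cvgB; exact: continuous_dramp. Qed.

Lemma continuous_plateau b r : continuous (plateau b r).
Proof. by move=> x; exact: is_derive_continuous (is_derive_plateau b r x). Qed.

Lemma plateau_out b r x : 0 < r -> 4 * r <= b -> (x <= r) || (b - r <= x) ->
  plateau b r x = 0.
Proof.
move=> r0 rb /orP[H|H]; rewrite /plateau.
  by rewrite !ramp_lo ?subrr//; lra.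
by rewrite !ramp_hi ?subrr//; lra.
Qed.

Lemma plateau_in b r x : 0 < r -> 2 * r <= x <= b - 2 * r -> plateau b r x = 1.
Proof. by move=> r0 /andP[? ?]; rewrite /plateau ramp_hi ?ramp_lo ?subr0//; lra. Qed.

Lemma norm_plateau b r x : `|plateau b r x| <= 1.
Proof.
rewrite /plateau /ramp.
have /andP[? ?] := step_ge0_le1 ((x - r) / r).
have /andP[? ?] := step_ge0_le1 ((x - (b - 2 * r)) / r).
by rewrite ler_norml; apply/andP; split; lra.
Qed.

Lemma Rintegral_itv_narrow h (b d : R) : d <= b ->
  (forall x, d <= x -> h x = 0) ->
  \int[mu]_(x in `]0, b[) h x = \int[mu]_(x in `]0, d[) h x.
Proof.
move=> db hd; rewrite Rintegral_mkcond [RHS]Rintegral_mkcond.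
apply: eq_Rintegral => x _; rewrite /patch !mem_setE !in_itv/=.
have [xd|dx] := ltP x d; first by rewrite (lt_le_trans xd db).
by rewrite andbF hd//; case: ifP.
Qed.

(** Test functions on (0, d) are defined on the whole line and vanish past d, hence also test on (0,
    b). Narrowing the integrals requires chi' = 0 past the support as well. *)
Lemma V0_narrow (b d : R) w g : 0 < d -> d <= b -> V0 b w g -> V0 d w g.
Proof.
move=> d0 db [wL gL wg wc w0]; split => //.
- by apply: L2S wL => //; apply: subset_itvl; rewrite bnd_simp.
- by apply: L2S gL => //; apply: subset_itvl; rewrite bnd_simp.
- move=> chi chi' chiC [c [e [c0 ed Hx]]].
  have dchi x : e < x -> chi' x = 0.
    move=> ex; have [/(_ x)[_ <-] _] := proj1 (C1_onTP _ _) chiC.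
    suff : is_derive x (1 : R) chi 0 by case.
    have out y : e < y -> chi y = 0.
      by move=> ey; rewrite Hx// in_itv/= negb_and -!ltNge ey orbT.
    apply/is_deriveP => eps eps0; near=> y.
    rewrite !out//; last by near: y; exact: lt_nbhsr.
    by rewrite subrr mul0r subrr normr0 mulr_ge0// ltW.
  rewrite -(@Rintegral_itv_narrow _ b d)//; last first.
    by move=> x dx; rewrite dchi ?mulr0//; exact: lt_le_trans dx.
  rewrite -(@Rintegral_itv_narrow _ b d)//; last first.
    move=> x dx; rewrite Hx ?mulr0// in_itv/= negb_and -!ltNge; apply/orP; right.
    exact: lt_le_trans dx.
  by apply: wg => //; exists c, e; split => //; exact: lt_le_trans db.
- by apply: continuous_subspaceW wc; apply: subset_itvl; rewrite bnd_simp.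
Unshelve. all: by end_near. Qed.

(** A sequence, so that dominated convergence applies; the factor 1/4 keeps the two flanks of
    [plateau] disjoint for every n. *)
Let rad (b : R) (n : nat) : R := (b / 4) / n.+1%:R.

Let rad_gt0 b n : 0 < b -> 0 < rad b n.
Proof. by move=> b0; rewrite !divr_gt0. Qed.

Let rad_le b n : 0 < b -> 4 * rad b n <= b.
Proof.
move=> b0; rewrite /rad mulrA mulrCA divff// mulr1 ler_pdivrMr//.
by rewrite ler_peMr ?ler1n// ltW.
Qed.

Let rad_cvg b : rad b n @[n --> \oo] --> 0.
Proof.
rewrite -(mulr0 (b / 4)); apply: cvgM; first exact: cvg_cst.
exact: cvg_harmonic.
Qed.

Lemma plateau_pairing_cvg b f : 0 < b -> integ `]0, b[ f ->
  \int[mu]_(x in `]0, b[) (f x * plateau b (rad b n) x) @[n --> \oo] -->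
  \int[mu]_(x in `]0, b[) f x.
Proof.
move=> b0 fi; apply: (@Rdominated_cvg _ _ _ _ (fun x => `|f x|)) => //.
- move=> n; apply: measurable_funM; first exact: integrable_meas fi.
  by apply: measurable_itv_continuous; apply: continuous_subspaceT; exact: continuous_plateau.
- move=> x; rewrite /= in_itv/= => /andP[x0 xb].
  apply: cvg_near_cst; near=> n.
  rewrite plateau_in ?mulr1//; first exact: rad_gt0.
  have H : `|0 - rad b n| <= Num.min (x / 2) ((b - x) / 2).
    near: n; move/cvgrPdist_le : (rad_cvg b); apply.
    by rewrite lt_min !divr_gt0// subr_gt0.
  move: H; rewrite sub0r normrN le_min => /andP[H1 H2].
  have := ler_norm (rad b n); move: H1 H2; set r := rad b n => *.
  apply/andP; split; lra.
- exact: integrable_norm.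
- move=> n x _; rewrite normrM ler_piMr//; exact: norm_plateau.
Unshelve. all: by end_near. Qed.

Lemma dplateau_pairing_cvg b h : 0 < b -> {within `[0, b], continuous h} ->
  \int[mu]_(x in `]0, b[) (h x * dplateau b (rad b n) x) @[n --> \oo] -->
  h 0 - h b.
Proof.
move=> b0 hc; apply/cvgrPdist_le => e e0.
have e2 : 0 < e / 2 by rewrite divr_gt0.
have m0 : `[0, b]%classic (0 : R) by rewrite /= in_itv/= lexx ltW.
have mb : `[0, b]%classic b by rewrite /= in_itv/= lexx ltW.
have /nbhs_ballP[d0 /= d00 H0] := proj1 (within_continuousP _ _) hc 0 m0 _ e2.
have /nbhs_ballP[d1 /= d10 H1] := proj1 (within_continuousP _ _) hc b mb _ e2.
near=> n.
have : `|0 - rad b n| <= Num.min (d0 / 3) (d1 / 3).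
  near: n; move/cvgrPdist_le : (rad_cvg b); apply.
  by rewrite lt_min !divr_gt0.
set r := rad b n.
have r0 : 0 < r by exact: rad_gt0.
have rb : 4 * r <= b by exact: rad_le.
rewrite sub0r normrN le_min => /andP[rd0 rd1].
have rr := ler_norm r.
have kc c : {within `[0, b], continuous (dramp c r)}.
  by apply: continuous_subspaceT; exact: continuous_dramp.
have ki c := continuous_itv_integrable (within_continuousM hc (kc c)).
have -> : \int[mu]_(x in `]0, b[) (h x * dplateau b r x) =
  \int[mu]_(x in `]0, b[) (h x * dramp r r x) -
  \int[mu]_(x in `]0, b[) (h x * dramp (b - 2 * r) r x).
  by rewrite -RintegralB//; apply: eq_Rintegral => x _; rewrite -mulrBr.
have A0 : `|\int[mu]_(x in `]0, b[) (h x * dramp r r x) - h 0| <= e / 2.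
  apply: dramp_localizes => //; [exact: ltW|lra|].
  move=> x /andP[x1 x2]; apply: H0; last by rewrite /= in_itv/=; apply/andP; split; lra.
  by rewrite /ball/= ltr_norml; apply/andP; split; lra.
have A1 : `|\int[mu]_(x in `]0, b[) (h x * dramp (b - 2 * r) r x) - h b| <= e / 2.
  apply: dramp_localizes => //; [lra|lra|].
  move=> x /andP[x1 x2]; apply: H1; last by rewrite /= in_itv/=; apply/andP; split; lra.
  by rewrite /ball/= ltr_norml; apply/andP; split; lra.
move: A0 A1; rewrite !ler_norml => /andP[? ?] /andP[? ?]; apply/andP; split; lra.
Unshelve. all: by end_near. Qed.

(** The weak derivative is tested against [plateau] times chi, and the cutoff is then removed. The
    derivative of the cutoff produces the boundary values, of which the one at 0 vanishes with w. *)
Lemma weak_deriv_by_parts b w g chi chi' : 0 < b -> V0 b w g ->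
  C1_on setT chi chi' ->
  \int[mu]_(x in `]0, b[) (g x * chi x) =
  w b * chi b - \int[mu]_(x in `]0, b[) (w x * chi' x).
Proof.
move=> b0 [wL gL wg wc w0] /[dup] chiC /C1_onTP[chiD chi'c].
have chic : continuous chi by move=> x; exact: is_derive_continuous (chiD x).
have chiw : {within `[0, b], continuous chi} by exact: continuous_subspaceT.
have chi'w : {within `[0, b], continuous chi'} by exact: continuous_subspaceT.
have gci : integ `]0, b[ (fun x => g x * chi x).
  by apply: L2_mul => //; exact: continuous_itv_L2.
have wci : integ `]0, b[ (fun x => w x * chi' x).
  by apply: L2_mul => //; exact: continuous_itv_L2.
pose P n := plateau b (rad b n); pose P' n := dplateau b (rad b n).
have PC n : C1_on setT (fun x => P n x * chi x) (fun x => P' n x * chi x + P n x * chi' x).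
  apply/C1_onTP; split.
    move=> x; have := is_deriveM (is_derive_plateau b (rad b n) x) (chiD x).
    by rewrite /GRing.scale/= addrC (mulrC (chi x)).
  move=> x; apply: cvgD; apply: cvgM; [exact: continuous_dplateau|exact: chic|exact: continuous_plateau|exact: chi'c].
have E n : \int[mu]_(x in `]0, b[) (g x * chi x * P n x) =
    - (\int[mu]_(x in `]0, b[) (w x * chi x * P' n x)) -
      \int[mu]_(x in `]0, b[) (w x * chi' x * P n x).
  have r0 := rad_gt0 n b0; have rb := rad_le n b0.
  have H := wg _ _ (PC n) _.
  have {}H := H (ex_intro _ (rad b n) (ex_intro _ (b - rad b n) _)).
  have -> : \int[mu]_(x in `]0, b[) (g x * chi x * P n x) =
     \int[mu]_(x in `]0, b[) (g x * (P n x * chi x)).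
    by apply: eq_Rintegral => x _; rewrite -mulrA (mulrC (chi x)).
  rewrite -[LHS]opprK -H; last first.
    split => //; first by rewrite ltrBlDr ltrDl.
    move=> x; rewrite in_itv/= negb_and -!ltNge => xr.
    rewrite /P plateau_out ?mul0r//; case/orP : xr => /ltW -> //.
    by rewrite orbT.
  rewrite -opprD -RintegralD//.
  - by congr (- _); apply: eq_Rintegral => x _; ring.
  - apply: continuous_itv_integrable; apply: within_continuousM; first exact: within_continuousM.
    by apply: continuous_subspaceT; exact: continuous_dplateau.
  - apply: L2_mul => //; last first.
      by apply: continuous_itv_L2; apply: continuous_subspaceT; exact: continuous_plateau.
    by apply: continuous_itv_L2; exact: within_continuousM.
have L1 := plateau_pairing_cvg b0 gci.
have EQ : (fun n => \int[mu]_(x in `]0, b[) (g x * chi x * P n x)) =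
    (fun n => - (\int[mu]_(x in `]0, b[) (w x * chi x * P' n x)) -
      \int[mu]_(x in `]0, b[) (w x * chi' x * P n x)) by exact/funext.
have L2 : (fun n => - (\int[mu]_(x in `]0, b[) (w x * chi x * P' n x)) -
      \int[mu]_(x in `]0, b[) (w x * chi' x * P n x)) @ \oo -->
    - (w 0 * chi 0 - w b * chi b) - \int[mu]_(x in `]0, b[) (w x * chi' x).
  apply: cvgB; last exact: plateau_pairing_cvg.
  by apply: cvgN; apply: dplateau_pairing_cvg => //; exact: within_continuousM.
rewrite -(cvg_lim (@norm_hausdorff _ _) L1) [X in lim (X @ _)]EQ.
by rewrite (cvg_lim (@norm_hausdorff _ _) L2) w0 mul0r sub0r opprK.
Qed.

(** By parts on (0, x) with chi = 1. Pointwise values of u thus become controlled by u_x in L^2. *)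
Lemma V0_primitive b w g x : V0 b w g -> 0 < x -> x <= b ->
  w x = \int[mu]_(y in `]0, x[) g y.
Proof.
move=> wV x0 xb.
have C1 : C1_on setT (cst 1 : R -> R) (cst 0).
  apply/C1_onTP; split; last by move=> ?; exact: cvg_cst.
  by move=> t; exact: is_derive_cst.
have := weak_deriv_by_parts x0 (V0_narrow x0 xb wV) C1.
rewrite /= mulr1; under eq_Rintegral do rewrite mulr1.
move=> ->; under eq_Rintegral do rewrite mulr0.
by rewrite Rintegral_cst// mul0r subr0.
Qed.

End by_parts.

(** * Pairings and primitives of square-integrable functions *)

Section pairings.
Context {R : realType}.
Local Notation mu := (@lebesgue_measure R).
Local Notation integ D f := (mu.-integrable D (EFin \o f)).
Implicit Types (f g h : R -> R) (t x : R).

(** Dividing by C + 1 instead of C keeps the choice of tolerances valid when C = 0. *)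
Lemma div_add1_mul_le (e C : R) : 0 < e -> 0 <= C -> e / (C + 1) * C <= e.
Proof. by move=> e0 C0; rewrite mulrAC ler_pdivrMr ?ltr_pwDr//; nra. Qed.

Lemma Rintegral_subset_le (D : set R) f : measurable D -> integ setT f ->
  (forall x, 0 <= f x) -> \int[mu]_(x in D) f x <= \int[mu]_x f x.
Proof.
move=> mD fi f0; rewrite Rintegral_mkcond; apply: le_Rintegral => //.
- apply: le_integrable_EFin (fi) => //.
    by apply/(measurable_restrictT f mD); apply: measurable_funTS; exact: integrable_meas fi.
  by move=> x _; rewrite /patch; case: ifP => _; rewrite ?normr0// ger0_norm.
- by move=> x _; rewrite /patch; case: ifP.
Qed.

Lemma is_derive_quotientP f s (a : R) : is_derive s (1 : R) f a <->
  (f t - f s) / (t - s) @[t --> s^'] --> a.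
Proof.
rewrite is_deriveP; split=> H.
  apply/cvgrPdist_le => e e0; have := H e e0; rewrite near_withinE.
  apply: filterS => t Ht ts.
  by rewrite distrC difference_quotient_le// subr_eq0.
move=> e e0; move/cvgrPdist_le : H => /(_ e e0); rewrite near_withinE.
apply: filterS => t Ht; have [->|ts] := eqVneq t s.
  by rewrite !subrr mulr0 subrr normr0 mulr0.
by rewrite -difference_quotient_le ?subr_eq0// distrC; exact: Ht.
Qed.

Lemma joint_slice (psi : R -> R -> R) t :
  continuous (fun z : R * R => psi z.1 z.2) -> continuous (psi^~ t).
Proof.
move=> pc x; apply/cvgrPdist_le => e e0.
have /cvgrPdist_le/(_ e e0)[[U V] /= [Ux Vt] UV] := pc (x, t).
by apply: filterS Ux => y Uy; apply: (UV (y, t)); split => //; exact: nbhs_singleton Vt.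
Qed.

Lemma cauchy_schwarz_norm (D : set R) f g : measurable D -> L2 D f -> L2 D g ->
  `|\int[mu]_(x in D) (f x * g x)| <=
  Num.sqrt (\int[mu]_(x in D) (f x ^+ 2)) * Num.sqrt (\int[mu]_(x in D) (g x ^+ 2)).
Proof.
move=> mD fD gD; rewrite -sqrtrM; last by apply: Rintegral_ge0 => x _; exact: sqr_ge0.
by rewrite -sqrtr_sqr ler_wsqrtr// cauchy_schwarz.
Qed.

(** The difference of the pairings is (f s - f0, h s) + (f0, h s - h0). The first is small by
    Cauchy-Schwarz, [h s] being eventually bounded by |M| + 1, the second by uniform closeness. *)
Lemma pairing_cvg (T : Type) (F : set_system T) (FF : Filter F) (D : set R)
    (f : T -> R -> R) f0 (h : T -> R -> R) h0 (M : R) :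
  measurable D -> (mu D < +oo)%E ->
  (\forall s \near F, L2 D (f s)) -> L2 D f0 ->
  \int[mu]_(x in D) ((f s x - f0 x) ^+ 2) @[s --> F] --> (0 : R) ->
  (\forall s \near F, measurable_fun D (h s)) -> measurable_fun D h0 ->
  (forall x, D x -> `|h0 x| <= M) ->
  (forall e : R, 0 < e -> \forall s \near F, forall x, D x -> `|h s x - h0 x| <= e) ->
  \int[mu]_(x in D) (f s x * h s x) @[s --> F] --> \int[mu]_(x in D) (f0 x * h0 x).
Proof.
move=> mD Dy fL f0L ff mh mh0 h0M hh.
have h0L : L2 D h0 by apply: bounded_L2 h0M.
set X := \int[mu]_(x in D) (f0 x * h0 x).
pose a s := Num.sqrt (\int[mu]_(x in D) ((f s x - f0 x) ^+ 2)).
pose C := Num.sqrt (\int[mu]_(x in D) ((`|M| + 1) ^+ 2)).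
pose I0 := \int[mu]_(x in D) `|f0 x|.
have acvg : a s @[s --> F] --> (0 : R).
  rewrite -(sqrtr0 R); apply: (cvg_comp _ _ ff).
  exact: sqrt_continuous.
have I00 : 0 <= I0 by apply: Rintegral_ge0.
apply/cvgrPdist_le => e e0.
have e1 : 0 < e / 2 / (I0 + 1) by rewrite !divr_gt0// ltr_pwDr.
have C0 : 0 <= C by exact: sqrtr_ge0.
have e2 : 0 < e / 2 / (C + 1) by rewrite !divr_gt0// ltr_pwDr.
near=> s.
have fsL : L2 D (f s) by near: s.
have hsm : measurable_fun D (h s) by near: s.
have hs1 x : D x -> `|h s x - h0 x| <= 1 by move: x; near: s; exact: hh.
have hse x : D x -> `|h s x - h0 x| <= e / 2 / (I0 + 1) by move: x; near: s; exact: hh.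
have ase : `|0 - a s| <= e / 2 / (C + 1) by near: s; move/cvgrPdist_le : acvg; exact.
have hsM x : D x -> `|h s x| <= `|M| + 1.
  move=> Dx; rewrite -(subrK (h0 x) (h s x)) (le_trans (ler_normD _ _))// addrC lerD ?hs1//.
  by rewrite (le_trans (h0M x Dx))// ler_norm.
have hsL : L2 D (h s) by apply: bounded_L2 hsM.
have f0i := L2_integrable mD Dy f0L.
have -> : X - \int[mu]_(x in D) (f s x * h s x) =
    - (\int[mu]_(x in D) ((f s x - f0 x) * h s x)) -
    \int[mu]_(x in D) (f0 x * (h s x - h0 x)).
  rewrite -opprD -RintegralD//; last 2 first.
  - by apply: L2_mul => //; exact: L2B.
  - by apply: L2_mul => //; exact: L2B.
  rewrite /X -RintegralB//; [|exact: L2_mul..]. rewrite -[LHS]opprK; congr (- _).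
  rewrite -mulN1r -RintegralZl//; last by apply: integrableB_EFin => //; exact: L2_mul.
  by apply: eq_Rintegral => x _; ring.
rewrite (le_trans (ler_normB _ _))// normrN.
have A1 : `|\int[mu]_(x in D) ((f s x - f0 x) * h s x)| <= e / 2.
  apply: (le_trans (cauchy_schwarz_norm mD (L2B mD fsL f0L) hsL)).
  have H1 : Num.sqrt (\int[mu]_(x in D) (h s x ^+ 2)) <= C.
    apply: ler_wsqrtr; apply: le_Rintegral => //; first exact: L2_sqr.
      apply: (@bounded_integrable _ _ _ ((`|M| + 1) ^+ 2)) => // x _.
      by rewrite ger0_norm// sqr_ge0.
    move=> x Dx; rewrite -(@real_normK _ (h s x)) ?num_real//.
    by rewrite lerXn2r ?nnegrE ?addr_ge0 ?hsM.
  have H2 : a s <= e / 2 / (C + 1).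
    by move: ase; rewrite sub0r normrN ger0_norm// sqrtr_ge0.
  apply: (le_trans (ler_pM (sqrtr_ge0 _) (sqrtr_ge0 _) H2 H1)).
  by apply: div_add1_mul_le => //; rewrite divr_gt0.
have A2 : `|\int[mu]_(x in D) (f0 x * (h s x - h0 x))| <= e / 2.
  have fi : integ D (fun x => f0 x * (h s x - h0 x)) by apply: L2_mul => //; exact: L2B.
  apply: (le_trans (le_normr_Rintegral _ fi)) => //.
  apply: (@le_trans _ _ (\int[mu]_(x in D) (e / 2 / (I0 + 1) * `|f0 x|))).
    apply: le_Rintegral => //; [exact: integrable_norm| |].
      by apply: integrableZ_EFin => //; exact: integrable_norm.
    by move=> x Dx; rewrite normrM mulrC ler_wpM2r// hse.
  rewrite RintegralZl//; last exact: integrable_norm.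
  by apply: div_add1_mul_le => //; rewrite divr_gt0.
by rewrite (splitr e) lerD.
Unshelve. all: by end_near. Qed.

Lemma Rintegral_itvoo0 f (a : R) : \int[mu]_(x in `]a, a[) f x = 0.
Proof. by rewrite Rintegral_mkcond set_itvoo0 patch_set0 Rintegral_cst// mul0r. Qed.

Lemma Rintegral_itv_split f (a b c : R) : a <= b -> b <= c ->
  integ `]a, c[ f ->
  \int[mu]_(x in `]a, c[) f x =
  \int[mu]_(x in `]a, b[) f x + \int[mu]_(x in `]b, c[) f x.
Proof.
rewrite le_eqVlt => /predU1P[<-|ab] bc fi.
  by rewrite Rintegral_itvoo0 add0r.
have E : `]a, c[%classic = `]a, b[ `|` `[b, c[ :> set R.
  apply/seteqP; split=> x /=; rewrite !in_itv/=.
    by move=> /andP[-> xc]; rewrite xc andbT; case: (ltP x b); [left|right].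
  by move=> [/andP[-> /lt_le_trans->]//|/andP[/(lt_le_trans ab)-> ->]].
rewrite [in LHS]E Rintegral_setU//; last 2 first.
- by rewrite -E.
- apply/disj_setPLR => x /=; rewrite !in_itv/= => /andP[_ xb] /andP[].
  by rewrite leNgt xb.
congr (_ + _); rewrite Rintegral_itv_obnd_cbnd//.
apply: integrableS fi => //; apply: subset_itvr; rewrite bnd_simp; exact: ltW.
Qed.

Lemma lebesgue_length x y : x <= y -> fine (mu `]x, y[%classic) = y - x.
Proof.
rewrite le_eqVlt => /predU1P[->|xy].
  by rewrite set_itvoo0 measure0 subrr.
by rewrite lebesgue_measure_itv /= lte_fin xy.
Qed.

(** Cauchy-Schwarz against the constant 1: a primitive of a square-integrable function is
    1/2-Hölder. *)
Lemma primitive_holder f x y : L2 setT f -> 0 <= x -> x <= y ->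
  `|\int[mu]_(z in `]0, y[) f z - \int[mu]_(z in `]0, x[) f z| <=
  Num.sqrt (y - x) * Num.sqrt (\int[mu]_z (f z ^+ 2)).
Proof.
move=> fL x0 xy.
have fI (a b : R) : integ `]a, b[ f.
  by apply: L2_integrable; [|exact: lty_itv|exact: L2S fL].
rewrite (Rintegral_itv_split x0 xy (fI _ _)) addrAC subrr add0r.
have -> : \int[mu]_(z in `]x, y[) f z = \int[mu]_(z in `]x, y[) (cst 1 z * f z).
  by apply: eq_Rintegral => z _; rewrite mul1r.
apply: (le_trans (cauchy_schwarz_norm _ _ _)) => //.
- apply: (@bounded_L2 _ _ _ 1) => //; first exact: lty_itv.
  by move=> z _; rewrite normr1.
- exact: L2S fL.
apply: ler_pM => //; apply: ler_wsqrtr.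
  under eq_Rintegral do rewrite expr1n.
  by rewrite Rintegral_cst// mul1r lebesgue_length.
by apply: Rintegral_subset_le => //; [exact: L2_sqr|move=> z; exact: sqr_ge0].
Qed.

(** Continuity at each point (x, s) extends to a tube around [a, b] by compactness. *)
Lemma joint_unif (psi : R -> R -> R) (a b s : R) :
  continuous (fun z : R * R => psi z.1 z.2) ->
  forall e : R, 0 < e -> \forall t \near s, forall x, a <= x <= b ->
    `|psi x t - psi x s| <= e.
Proof.
move=> pc e e0.
have cpt : compact `[a, b]%classic := @segment_compact R a b.
have := proj1 (compact_near_coveringP _) cpt R (nbhs s)
  (fun t x => `|psi x t - psi x s| <= e) _.
move=> H; have {H} : \forall t \near s, `[a, b]%classic `<=` (fun x => `|psi x t - psi x s| <= e).
  apply: H => x xab.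
  have /cvgrPdist_le /(_ (e / 2)) := pc (x, s).
  rewrite divr_gt0// => /(_ isT) [[U V] /= [Ux Vs] UV].
  exists (U, V) => //= -[y t] [/= Uy Vt].
  have H1 := UV (y, t) (conj Uy Vt); have H2 := UV (y, s) (conj Uy (nbhs_singleton Vs)).
  move: H1 H2 => /=; rewrite !ler_norml => /andP[? ?] /andP[? ?]; apply/andP; split; lra.
by apply: filterS => t H x xab; apply: H; rewrite /= in_itv.
Qed.

(** Mean value theorem for y |-> Th (y + x) - Th' (s + x) y, whose derivative is small uniformly in
    x by [joint_unif]. *)
Lemma increment_unif (Th Th' : R -> R) (B s : R) :
  (forall t, is_derive t (1 : R) Th (Th' t)) -> continuous Th' ->
  forall e : R, 0 < e -> \forall t \near s, forall x, - B <= x <= B ->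
    `|Th (t + x) - Th (s + x) - Th' (s + x) * (t - s)| <= e * `|t - s|.
Proof.
move=> ThD Thc e e0.
have J : continuous (fun z : R * R => (fun x t => Th' (t + x)) z.1 z.2).
  by move=> z; apply: (@continuous_comp _ _ _ (fun z : R * R => z.2 + z.1) Th');
    [apply: cvgD; [exact: cvg_snd|exact: cvg_fst]|exact: Thc].
have /nbhs_ballP[d /= d0 Hd] := @joint_unif (fun x t => Th' (t + x)) (- B) B s J e e0.
apply/nbhs_ballP; exists d => //= t td x xB.
have gD (z : R) : is_derive z (1 : R) (fun y => Th (y + x) - Th' (s + x) * y) (Th' (z + x) - Th' (s + x)).
  have H1 := @is_derive_affine _ Th 1 x z (Th' (z + x)).
  rewrite mulr1 mul1r in H1; move: (H1 (ThD _)).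
  under eq_fun do rewrite mul1r.
  move=> {}H1; have := is_deriveB H1 (is_deriveZ (Th' (s + x)) (is_derive_id z (1 : R))).
  by rewrite /GRing.scale/= mulr1.
have gc z : {for z, continuous (fun y => Th (y + x) - Th' (s + x) * y)}.
  exact: is_derive_continuous (gD z).
have mvt (p q : R) : p <= q -> (forall z, p <= z <= q -> ball s d z) ->
    `|Th (q + x) - Th (p + x) - Th' (s + x) * (q - p)| <= e * `|q - p|.
  move=> pq Hb; have [c cpq E] := @MVT_segment _ (fun y => Th (y + x) - Th' (s + x) * y)
    (fun z => Th' (z + x) - Th' (s + x)) p q pq (fun z _ => gD z) (continuous_subspaceT gc).
  have -> : Th (q + x) - Th (p + x) - Th' (s + x) * (q - p) =
     (Th' (c + x) - Th' (s + x)) * (q - p) by rewrite -E; ring.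
  rewrite normrM ler_wpM2r//; apply: (Hd c) => //; apply: Hb.
  by move: cpq; rewrite in_itv.
move: td; rewrite /ball/= ltr_norml => /andP[td1 td2].
have [st|ts] := leP s t.
  apply: mvt => // z /andP[? ?]; rewrite /ball/= ltr_norml; apply/andP; split; lra.
have -> : Th (t + x) - Th (s + x) - Th' (s + x) * (t - s) =
  - (Th (s + x) - Th (t + x) - Th' (s + x) * (s - t)) by ring.
rewrite normrN (distrC t s).
by apply: mvt (ltW ts) _ => z /andP[? ?]; rewrite /ball/= ltr_norml; apply/andP; split; lra.
Qed.

Lemma is_derive_near_eq f g s (a : R) : (\forall t \near s, f t = g t) ->
  is_derive s (1 : R) f a -> is_derive s (1 : R) g a.
Proof.
move=> fg /is_deriveP H; apply/is_deriveP => e /H.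
by rewrite (nbhs_singleton fg); apply: filterS2 fg => t ->.
Qed.

Lemma is_derive_primitive (f : R -> R) a s : {within `[a, +oo[, continuous f} ->
  a < s -> is_derive s (1 : R) (fun T => \int[mu]_(x in `]a, T[) f x) (f s).
Proof.
move=> fc s0.
have fi T : integ `]a, T[ f.
  apply: continuous_itv_integrable; apply: continuous_subspaceW fc.
  by apply: subset_itvl; rewrite bnd_simp.
have fi' T : integ `]a, T] f.
  apply: integrableS (continuous_integrable_itv (_ : {within `[a, T], continuous f})) => //.
    exact: subset_itv_oc_cc.
  by apply: continuous_subspaceW fc; apply: subset_itvl; rewrite bnd_simp.
have fs : {for s, continuous f}.
  apply/cvgrPdist_le => e e0; have := proj1 (within_continuousP _ _) fc s _ e e0.
  rewrite /= in_itv/= andbT => /(_ (ltW s0)); apply: filterS2 (lt_nbhsr s0) => t t0 Ht.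
  by rewrite distrC; apply: Ht; rewrite in_itv/= andbT ltW.
have s1 : s < s + 1 by rewrite ltrDl.
have [] := @continuous_FTC1 _ f (BRight a) s (s + 1) s1 (fi' _) _ fs.
  exact: s0.
move=> dF F'; have {}dF : is_derive s (1 : R) (fun T => \int[mu]_(x in `]a, T]) f x) (f s).
  by apply: DeriveDef; [exact: dF|rewrite -derive1E; exact: F'].
apply: is_derive_near_eq dF; near=> T.
by rewrite Rintegral_itv_bndo_bndc.
Unshelve. all: by end_near. Qed.

End pairings.

(** * Functions on a moving interval *)

Section moving_domain.
Context {R : realType}.
Local Notation mu := (@lebesgue_measure R).
Local Notation integ D f := (mu.-integrable D (EFin \o f)).
Variables (l : R -> R).
Hypothesis l_cont : {within `[0, +oo[, continuous l}.
Hypothesis l_pos : forall t, 0 <= t -> 0 < l t.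
Implicit Types (w u ux ut : R -> R -> R) (s t x : R).

Local Notation future s := (within (`[0, +oo[%classic : set R) (nbhs s)).

Definition ext w t : R -> R := (w^~ t) \_ `]0, l t[.

Lemma ext_in w t x : 0 < x < l t -> ext w t x = w x t.
Proof. by move=> xl; rewrite /ext /patch mem_setE in_itv/= xl. Qed.

Lemma ext_out w t x : ~~ (0 < x < l t) -> ext w t x = 0.
Proof. by move=> xl; rewrite /ext /patch mem_setE in_itv/= (negbTE xl). Qed.

Lemma ext_L2 w t : C0_L2 l w -> 0 <= t -> L2 setT (ext w t).
Proof. by move=> [wL _] t0; apply: (proj1 (L2_restrict _ _)) => //; exact: wL. Qed.

Lemma Rintegral_ext w t (h : R -> R) (B : R) : l t <= B ->
  \int[mu]_(x in `]0, l t[) (w x t * h x) =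
  \int[mu]_(x in `]0, B[) (ext w t x * h x).
Proof.
move=> lB; rewrite (@Rintegral_itv_narrow _ (fun x => ext w t x * h x) B (l t))//; last first.
  by move=> x lx; rewrite ext_out ?mul0r// negb_and -!leNgt lx orbT.
by apply: eq_Rintegral => x; rewrite inE/= in_itv/= => xl; rewrite ext_in.
Qed.

Definition gap w s t : R := \int[mu]_x ((ext w t x - ext w s x) ^+ 2).

Lemma gap_cvg w s : C0_L2 l w -> 0 <= s -> gap w s t @[t --> future s] --> 0.
Proof. by move=> [_ wc] s0; apply: (@L2norm_cvg_int _ _ _ _ (fun=> setT)); exact: wc. Qed.

Lemma gap_le w s t (D : set R) : measurable D -> C0_L2 l w -> 0 <= s -> 0 <= t ->
  \int[mu]_(x in D) ((ext w t x - ext w s x) ^+ 2) <= gap w s t.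
Proof.
move=> mD wC s0 t0; have dL := L2B measurableT (ext_L2 wC t0) (ext_L2 wC s0).
by apply: Rintegral_subset_le => //; [exact: L2_sqr|move=> z; exact: sqr_ge0].
Qed.

Lemma future_ge0 s : \forall t \near future s, 0 <= t.
Proof. by rewrite near_withinE; near=> t; rewrite /= in_itv/= andbT. Unshelve. all: by end_near. Qed.

Lemma l_bounded s : 0 <= s -> \forall t \near future s, l t <= l s + 1.
Proof.
move=> s0; have := proj1 (within_continuousP _ _) l_cont s _ 1 ltr01.
rewrite /= in_itv/= andbT => /(_ s0); rewrite near_withinE; apply: filterS => t H tD.
by have := H tD; rewrite ler_norml => /andP[_]; rewrite lerBlDr addrC.
Qed.

Lemma joint_measurable (psi : R -> R -> R) t (D : set R) : measurable D ->
  continuous (fun z : R * R => psi z.1 z.2) -> measurable_fun D (psi^~ t).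
Proof.
move=> mD pc; apply: measurable_funTS; apply: continuous_measurable_fun.
exact: joint_slice.
Qed.

Lemma joint_bounded (psi : R -> R -> R) t (a b : R) :
  continuous (fun z : R * R => psi z.1 z.2) ->
  exists2 M, 0 <= M & forall x, x \in `[a, b] -> `|psi x t| <= M.
Proof.
move=> pc; apply: continuous_itv_bounded; apply: continuous_subspaceT.
exact: joint_slice.
Qed.

(** For t near s the interval (0, l t) lies in the fixed interval (0, l s + 1), and extension by
    zero reduces the claim to [pairing_cvg] there. *)
Lemma moving_pairing_cvg w (h : R -> R -> R) (h0 : R -> R) s :
  C0_L2 l w -> 0 <= s ->
  (forall t, measurable_fun setT (h t)) -> {within `[0, l s + 1], continuous h0} ->
  (forall e : R, 0 < e -> \forall t \near future s, forall x, 0 <= x <= l s + 1 ->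
     `|h t x - h0 x| <= e) ->
  \int[mu]_(x in `]0, l t[) (w x t * h t x) @[t --> future s] -->
  \int[mu]_(x in `]0, l s[) (w x s * h0 x).
Proof.
move=> wC s0 mh h0c hh; have [M _ HM] := continuous_itv_bounded h0c.
set B := l s + 1.
rewrite (@Rintegral_ext w s h0 B); last by rewrite /B lerDl.
have H : \int[mu]_(x in `]0, B[) (ext w t x * h t x) @[t --> future s] -->
    \int[mu]_(x in `]0, B[) (ext w s x * h0 x).
  apply: (@pairing_cvg _ _ _ _ _ _ _ _ _ M) => //.
  - exact: lty_itv.
  - by near=> t; apply: L2S (ext_L2 wC _) => //; near: t; exact: future_ge0.
  - by apply: L2S (ext_L2 wC _).
  - apply: (@squeeze_cvgr _ _ _ _ (cst 0) (gap w s)); [|exact: cvg_cst|exact: gap_cvg].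
    near=> t; apply/andP; split; first by apply: Rintegral_ge0 => x _; exact: sqr_ge0.
    by apply: gap_le => //; near: t; exact: future_ge0.
  - by near=> t; apply: measurable_funTS.
  - exact: measurable_itv_continuous.
  - by move=> x /= xB; apply: HM; exact: subset_itv_oo_cc xB.
  - move=> e e0; near=> t; move=> x /=; rewrite in_itv/= => /andP[x0 xB].
    have : 0 <= x <= l s + 1 by rewrite !ltW.
    by move: x {x0 xB}; near: t; exact: hh.
apply: cvg_trans H; apply: near_eq_cvg; near=> t.
by rewrite (@Rintegral_ext w t (h t) B)//; near: t; exact: l_bounded.
Unshelve. all: by end_near. Qed.

Lemma joint_pairing_cvg w (psi : R -> R -> R) s : C0_L2 l w -> 0 <= s ->
  continuous (fun z : R * R => psi z.1 z.2) ->
  \int[mu]_(x in `]0, l t[) (w x t * psi x t) @[t --> future s] -->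
  \int[mu]_(x in `]0, l s[) (w x s * psi x s).
Proof.
move=> wC s0 pc; apply: moving_pairing_cvg => //.
- by move=> t; exact: joint_measurable.
- by apply: continuous_subspaceT; exact: joint_slice.
- move=> e e0; rewrite near_withinE; apply: filterS (joint_unif 0 (l s + 1) s pc e0).
  by move=> t H _ x; exact: H.
Qed.

(** Since u (., t) is the primitive of u_x from 0, changing t costs the L^2 gap of u_x, and moving x
    towards l s costs the Hölder modulus at time s. *)
Lemma trace_uniform u ux s : C0_V0 l u ux -> 0 <= s -> forall e : R, 0 < e ->
  exists2 d : R, 0 < d & \forall t \near future s, forall x, 0 < x -> x <= l t ->
    `|x - l s| <= d -> `|u x t - u (l s) s| <= e.
Proof.
move=> [uV uC uxC] s0 e e0.
have prim t x : 0 <= t -> 0 < x -> x <= l t -> u x t = \int[mu]_(y in `]0, x[) ext ux t y.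
  move=> t0 x0 xl; rewrite (V0_primitive (uV t t0) x0 xl).
  apply: eq_Rintegral => y; rewrite inE/= in_itv/= => /andP[y0 yx].
  by rewrite ext_in// y0 (lt_le_trans yx).
have sL := ext_L2 uxC s0.
pose N := Num.sqrt (\int[mu]_y (ext ux s y ^+ 2)).
have N0 : 0 <= N by exact: sqrtr_ge0.
(* The bound 1 keeps x below l s + 1; the square makes the Hölder term [Num.sqrt d * N] at most e /
   2. *)
pose d := Num.min 1 ((e / 2 / (N + 1)) ^+ 2).
have d0 : 0 < d by rewrite lt_min ltr01 exprn_gt0// !divr_gt0// ltr_pwDr.
have sd : Num.sqrt d * N <= e / 2.
  have H : Num.sqrt d <= e / 2 / (N + 1).
    have q0 : 0 <= e / 2 / (N + 1) by rewrite !divr_ge0 ?addr_ge0// ltW.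
    rewrite -[leRHS](ger0_norm q0) -sqrtr_sqr; apply: ler_wsqrtr.
    by rewrite /d ge_min lexx orbT.
  apply: (le_trans (ler_wpM2r N0 H)).
  by apply: div_add1_mul_le => //; rewrite divr_gt0.
exists d => //.
pose C := Num.sqrt (l s + 1).
have C0 : 0 <= C by exact: sqrtr_ge0.
have gs : Num.sqrt (gap ux s t) @[t --> future s] --> (0 : R).
  have : Num.sqrt (gap ux s t) @[t --> future s] --> Num.sqrt (0 : R).
    by apply: (cvg_comp _ _ (gap_cvg uxC s0)); exact: sqrt_continuous.
  by rewrite sqrtr0.
have e2 : 0 < e / 2 / (C + 1) by rewrite !divr_gt0// ltr_pwDr.
near=> t; move=> x x0 xl xd.
have t0 : 0 <= t by near: t; exact: future_ge0.
have tL := ext_L2 uxC t0.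
have gt : `|0 - Num.sqrt (gap ux s t)| <= e / 2 / (C + 1).
  by near: t; move/cvgrPdist_le : gs; exact.
rewrite (prim t x)// (prim s (l s)) ?l_pos//.
have xi f : L2 setT f -> integ `]0, x[ f.
  by move=> fL; apply: L2_integrable; [|exact: lty_itv|exact: L2S fL].
(* The intermediate value is the primitive of the zero extension of u_x at time s rather than u x s,
   so that it remains meaningful when x > l s. *)
rewrite -(subrK (\int[mu]_(y in `]0, x[) ext ux s y) (\int[mu]_(y in `]0, x[) ext ux t y)).
rewrite -addrA (le_trans (ler_normD _ _))// (splitr e) lerD//.
- rewrite -RintegralB ?xi//.
  have := primitive_holder (L2B measurableT tL sL) (lexx 0) (ltW x0).
  rewrite Rintegral_itvoo0 !subr0.
  move=> /le_trans; apply.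
  have H1 : Num.sqrt x <= C.
    apply: ler_wsqrtr; have : d <= 1 by rewrite /d ge_min lexx.
    by move: xd; rewrite ler_norml => /andP[_ ? ?]; lra.
  have H2 : Num.sqrt (gap ux s t) <= e / 2 / (C + 1).
    by move: gt; rewrite sub0r normrN ger0_norm// sqrtr_ge0.
  apply: (le_trans (ler_pM (sqrtr_ge0 _) (sqrtr_ge0 _) H1 H2)).
  by rewrite mulrC; apply: div_add1_mul_le => //; rewrite divr_gt0.
- apply: le_trans sd.
  have [xs|sx] := leP x (l s).
    rewrite distrC; apply: (le_trans (primitive_holder sL (ltW x0) xs)).
    rewrite ler_wpM2r// ler_wsqrtr//; apply: le_trans xd.
    by rewrite distrC ler_norm.
  apply: (le_trans (primitive_holder sL (ltW (l_pos s0)) (ltW sx))).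
  rewrite ler_wpM2r// ler_wsqrtr//; apply: le_trans xd.
  by rewrite ler_norm.
Unshelve. all: by end_near. Qed.

Lemma trace_cvg u ux s : C0_V0 l u ux -> 0 <= s ->
  u (l t) t @[t --> future s] --> u (l s) s.
Proof.
move=> uV s0; apply/cvgrPdist_le => e e0.
have [d d0 H] := trace_uniform uV s0 e0.
near=> t; have t0 : 0 <= t by near: t; exact: future_ge0.
rewrite distrC; move: (near H t) => /(_ _ (l t)); apply => //; first exact: l_pos.
near: t; have := proj1 (within_continuousP _ _) l_cont s _ d d0.
by rewrite /= in_itv/= andbT => /(_ s0); rewrite near_withinE.
Unshelve. all: by end_near. Qed.

End moving_domain.

Section moving_increments.
Context {R : realType}.
Local Notation mu := (@lebesgue_measure R).
Local Notation integ D f := (mu.-integrable D (EFin \o f)).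
Variables (l l' : R -> R) (u ux ut : R -> R -> R) (s : R).
Hypothesis l_cont : {within `[0, +oo[, continuous l}.
Hypothesis l_pos : forall t, 0 <= t -> 0 < l t.
Hypothesis uV : C0_V0 l u ux.
Hypothesis uC : C1_L2 l u ut.
Hypothesis s0 : 0 < s.
Hypothesis l_deriv : is_derive s (1 : R) l (l' s).
Implicit Types (t x : R).

Local Notation future := (within (`[0, +oo[%classic : set R) (nbhs s)).
Local Notation m t := (Order.min (l t) (l s)).

(** As s > 0, times close to s are nonnegative, so continuity within [0, +oo[ passes to two-sided
    limits. *)
Lemma dnbhs_future (P : set R) : (\forall t \near future, P t) ->
  \forall t \near s^', P t.
Proof.
rewrite !near_withinE => H; near=> t => ts.
have : t \in `[0, +oo[ -> P t by near: t; exact: H.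
by apply; rewrite in_itv/= andbT ltW//; near: t; exact: lt_nbhsr.
Unshelve. all: by end_near. Qed.

Lemma cvg_dnbhs_future (f : R -> R) (y : R) : f @ future --> y -> f @ s^' --> y.
Proof.
by move=> /cvgrPdist_le H; apply/cvgrPdist_le => e e0; apply: dnbhs_future; exact: H.
Qed.

Definition quotient t : R -> R :=
  (fun x => (u x t - u x s) / (t - s)) \_ `]0, m t[.

Let s_ge0 : 0 <= s. Proof. exact: ltW. Qed.

Lemma u_L2_narrow t r : 0 <= r -> m t <= l r -> L2 `]0, m t[ (u^~ r).
Proof.
move=> r0 mr; case: uC => -[uL _] _ _; apply: L2S (uL r r0) => //.
by apply: subset_itvl; rewrite bnd_simp.
Qed.

Lemma quotient_L2 t : 0 <= t -> L2 setT (quotient t).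
Proof.
move=> t0; apply: (proj1 (L2_restrict _ _)) => //.
apply: (@L2_ext _ _ (fun x => (t - s)^-1 * (u x t - u x s))) => //.
  by move=> x _ /=; rewrite mulrC.
apply: L2Z => //; apply: L2B => //; apply: u_L2_narrow => //.
  by rewrite ge_min lexx.
by rewrite ge_min lexx orbT.
Qed.

(* Where the two domains differ, i.e. between l t and l s, either both sides vanish
   or [ext ut t] does, and the strip is controlled by the continuity of u_t. *)
Lemma quotient_cvg :
  \int[mu]_x ((quotient t x - ext l ut s x) ^+ 2) @[t --> s^'] --> 0.
Proof.
have [_ utC uD] := uC.
pose q t x := (u x t - u x s) / (t - s) - ut x s.
have Hq : \int[mu]_(x in `]0, m t[) (q t x ^+ 2) @[t --> s^'] --> (0 : R).
  have H := @L2norm_cvg_int _ _ _ _ (fun t => `]0, m t[%classic) _ (uD s s_ge0).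
  have FF : Filter (within (`[0, +oo[%classic : set R) s^') by exact: within_filter.
  apply/cvgrPdist_le => e e0; move/cvgrPdist_le : (H FF) => /(_ e e0).
  rewrite !near_withinE => {}H; near=> t => ts.
  have Ht : t \in `[0, +oo[ by rewrite in_itv/= andbT ltW//; near: t; exact: lt_nbhsr.
  by move: ts Ht; near: t; rewrite -near_withinE -near_withinE.
have Hg : gap l ut s t @[t --> s^'] --> (0 : R).
  by apply: cvg_dnbhs_future; exact: gap_cvg.
apply: (@squeeze_cvgr _ _ _ _ (cst 0)
   (fun t => \int[mu]_(x in `]0, m t[) (q t x ^+ 2) + gap l ut s t)).
- near=> t; have t0 : 0 <= t by near: t; apply: dnbhs_future; exact: future_ge0.
  apply/andP; split; first by apply: Rintegral_ge0 => x _; exact: sqr_ge0.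
  have gL : L2 setT (fun x => ext l ut t x - ext l ut s x).
    by apply: L2B => //; exact: ext_L2.
  have qL : L2 setT (q t \_ `]0, m t[).
    apply: (proj1 (L2_restrict _ _)) => //; apply: L2B => //.
      by apply: (proj2 (L2_restrict _ _)) => //; exact: quotient_L2.
    case: utC => /(_ s s_ge0) utL _; apply: L2S utL => //.
    by apply: subset_itvl; rewrite bnd_simp ge_min lexx orbT.
  have -> : \int[mu]_(x in `]0, m t[) (q t x ^+ 2) = \int[mu]_x ((q t \_ `]0, m t[) x ^+ 2).
    rewrite Rintegral_mkcond; apply: eq_Rintegral => x _.
    by rewrite /patch; case: ifP => // _; rewrite expr0n.
  rewrite /gap -RintegralD ?L2_sqr//.
  apply: le_Rintegral => //.
  + by apply: L2_sqr => //; apply: L2B => //; [exact: quotient_L2|exact: ext_L2].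
  + by apply: integrableD_EFin => //; exact: L2_sqr.
  move=> x _; rewrite /quotient {1}/patch [in X in _ <= X + _]/patch mem_setE in_itv/=.
  case: ifPn => xm.
    have xs : 0 < x < l s by case/andP: xm => ->; rewrite lt_min => /andP[].
    by rewrite (ext_in _ xs) lerDl sqr_ge0.
  have [xs|xs] := boolP (0 < x < l s).
    rewrite (@ext_out _ _ _ t) ?expr0n ?add0r//.
    by apply: contra xm => /andP[x0 xt]; rewrite x0 lt_min xt; case/andP: xs.
  by rewrite (ext_out _ xs) subrr expr0n addr_ge0 ?sqr_ge0.
- exact: cvg_cst.
- by rewrite -[X in _ --> X](addr0 (0 : R)); exact: cvgD.
Unshelve. all: by end_near. Qed.

Variables (h : R -> R -> R) (h0 : R -> R).
Hypothesis mh : forall t, measurable_fun setT (h t).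
Hypothesis h0c : {within `[0, l s + 1], continuous h0}.
Hypothesis hh : forall e : R, 0 < e -> \forall t \near future,
  forall x, 0 <= x <= l s + 1 -> `|h t x - h0 x| <= e.
Hypothesis hc : forall t, continuous (h t).

(** The bulk part of the increment: the zero-extended difference quotients converge to u_t in L^2 of
    the line, and [pairing_cvg] applies on (0, l s + 1). *)
Lemma increment_pairing_cvg :
  \int[mu]_(x in `]0, m t[) ((u x t - u x s) / (t - s) * h t x) @[t --> s^'] -->
  \int[mu]_(x in `]0, l s[) (ut x s * h0 x).
Proof.
have [M _ HM] := continuous_itv_bounded h0c; have [_ utC _] := uC.
set B := l s + 1.
rewrite (@Rintegral_ext _ l ut s h0 B); last by rewrite /B lerDl.
have H : \int[mu]_(x in `]0, B[) (quotient t x * h t x) @[t --> s^'] -->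
    \int[mu]_(x in `]0, B[) (ext l ut s x * h0 x).
  apply: (@pairing_cvg _ _ _ _ _ _ _ _ _ M) => //.
  - exact: lty_itv.
  - near=> t; apply: L2S (quotient_L2 _) => //; near: t; apply: dnbhs_future; exact: future_ge0.
  - by apply: L2S (ext_L2 utC _).
  - apply: (@squeeze_cvgr _ _ _ _ (cst 0)
      (fun t => \int[mu]_x ((quotient t x - ext l ut s x) ^+ 2))); [|exact: cvg_cst|exact: quotient_cvg].
    near=> t; apply/andP; split; first by apply: Rintegral_ge0 => x _; exact: sqr_ge0.
    apply: Rintegral_subset_le => //; last by move=> x; exact: sqr_ge0.
    apply: L2_sqr => //; apply: L2B => //; last exact: ext_L2.
    by apply: quotient_L2; near: t; apply: dnbhs_future; exact: future_ge0.
  - by near=> t; apply: measurable_funTS.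
  - exact: measurable_itv_continuous.
  - by move=> x /= xB; apply: HM; exact: subset_itv_oo_cc xB.
  - move=> e e0; near=> t; move=> x /=; rewrite in_itv/= => /andP[x0 xB].
    have : 0 <= x <= l s + 1 by rewrite !ltW.
    by move: x {x0 xB}; near: t; apply: dnbhs_future; exact: hh.
apply: cvg_trans H; apply: near_eq_cvg; near=> t.
rewrite (@Rintegral_itv_narrow _ (fun x => quotient t x * h t x) B (m t)).
- by apply: eq_Rintegral => x; rewrite inE/= => xm; rewrite /quotient /patch mem_setE xm.
- by rewrite ge_min /B lerDl ler01 orbT.
- by move=> x mx; rewrite /quotient /patch mem_setE in_itv/= [x < _]ltNge mx andbF mul0r.
Unshelve. all: by end_near. Qed.

(** On the thin strip between l s and l t the integrand is close to its value at (l s, s), whichever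
    of the two times the strip belongs to. *)
Lemma layer_uniform (e : R) : 0 < e -> exists2 d : R, 0 < d &
  \forall t \near future, forall x, 0 < x -> `|x - l s| <= d ->
    (x <= l t -> `|u x t * h t x - u (l s) s * h0 (l s)| <= e) /\
    (x <= l s -> `|u x s * h t x - u (l s) s * h0 (l s)| <= e).
Proof.
move=> e0; set v := u (l s) s; set k := h0 (l s).
have k1 : 0 < `|k| + 1 by rewrite ltr_pwDr.
have v1 : 0 < `|v| + 1 by rewrite ltr_pwDr.
pose eu := e / 2 / (`|k| + 1); pose eh := Num.min 1 (e / 2 / (`|v| + 1)).
have eu0 : 0 < eu by rewrite !divr_gt0.
have eh0 : 0 < eh by rewrite lt_min ltr01 !divr_gt0.
have [d1 d10 Hu] := trace_uniform l_pos uV s_ge0 eu0.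
have ls0 := l_pos s_ge0.
have lsD : `[0, l s + 1]%classic (l s) by rewrite /= in_itv/= lerDl ler01 ltW.
have eh2 : 0 < eh / 2 by rewrite divr_gt0.
have /nbhs_ballP[d2 /= d20 Hh] := proj1 (within_continuousP _ _) h0c _ lsD _ eh2.
pose d := Num.min d1 (Num.min (d2 / 2) 1).
have d0 : 0 < d by rewrite !lt_min d10 ltr01 divr_gt0.
(* The trace estimate taken at t = s itself, for the strip left behind when the interval shrinks. *)
have Hus := Hu; rewrite near_withinE in Hus.
have {}Hus := nbhs_singleton Hus; rewrite /= in_itv/= s_ge0 /= in Hus.
exists d => //; near=> t; move=> x x0 xd.
have : d <= d1 by rewrite /d ge_min lexx.
have : d <= d2 / 2 by rewrite /d !ge_min lexx orbT.
have : d <= 1 by rewrite /d !ge_min lexx !orbT.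
move=> d_1 d_2 d_d1.
have hx : `|h t x - k| <= eh.
  have xB : 0 <= x <= l s + 1.
    by move: xd; rewrite ler_norml => /andP[? ?]; apply/andP; split; lra.
  have A1 : `|h t x - h0 x| <= eh / 2.
    by move: x xB {x0 xd}; near: t; exact: hh.
  have A2 : `|h0 x - k| <= eh / 2.
    apply: Hh; last by rewrite /= in_itv/=.
    by rewrite /ball/= distrC; lra.
  by rewrite (splitr eh) -(subrK (h0 x) (h t x)) -addrA (le_trans (ler_normD _ _))// lerD.
have prod z : `|z - v| <= eu -> `|z * h t x - v * k| <= e.
  move=> zv.
  have -> : z * h t x - v * k = (z - v) * h t x + v * (h t x - k) by ring.
  have hk : `|h t x| <= `|k| + 1.
    rewrite -(subrK k (h t x)) (le_trans (ler_normD _ _))// addrC lerD//.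
    by apply: (le_trans hx); rewrite /eh ge_min lexx.
  rewrite (le_trans (ler_normD _ _))// !normrM (splitr e) lerD//.
    apply: (le_trans (ler_pM _ _ zv hk)) => //.
    by rewrite /eu mulrAC ler_pdivrMr.
  apply: (@le_trans _ _ (`|v| * (e / 2 / (`|v| + 1)))).
    by rewrite ler_wpM2l//; apply: (le_trans hx); rewrite /eh ge_min lexx orbT.
  by rewrite mulrC; apply: div_add1_mul_le => //; rewrite divr_gt0.
have xd1 : `|x - l s| <= d1 by exact: le_trans xd d_d1.
split=> xl; apply: prod; last exact: Hus.
by move: x x0 xl xd1 {xd hx}; near: t; exact: Hu.
Unshelve. all: by end_near. Qed.

(** Signed contribution of the strip between l s and l t: one of the two intervals is always
    empty. *)
Let layer t := \int[mu]_(x in `]m t, l t[) (u x t * h t x) -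
  \int[mu]_(x in `]m t, l s[) (u x s * h t x).

Lemma u_h_integrable t r a b : 0 <= r -> 0 <= a -> b <= l r ->
  integ `]a, b[ (fun x => u x r * h t x).
Proof.
move=> r0 a0 br.
have hL : L2 `]a, b[ (h t) by apply: continuous_itv_L2; exact: continuous_subspaceT.
apply: L2_mul => //; case: uC => -[uL _] _ _; apply: L2S (uL r r0) => //.
by apply: subset_itv; rewrite bnd_simp.
Qed.

Lemma strip_estimate t r a b (c e : R) : 0 <= r -> 0 < a -> a <= b -> b <= l r ->
  (forall x, a < x < b -> `|u x r * h t x - c| <= e) ->
  `|\int[mu]_(x in `]a, b[) (u x r * h t x) - c * (b - a)| <= e * (b - a).
Proof.
move=> r0 a0 ab bl H.
have ui := u_h_integrable t r0 (ltW a0) bl.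
have ci (k : R) : integ `]a, b[ (cst k).
  by apply: (@bounded_integrable _ _ _ `|k|) => //; exact: lty_itv.
have -> : c * (b - a) = \int[mu]_(x in `]a, b[) c by rewrite Rintegral_cst// lebesgue_length.
have -> : e * (b - a) = \int[mu]_(x in `]a, b[) e by rewrite Rintegral_cst// lebesgue_length.
rewrite -RintegralB//; last exact: ci.
have di := integrableB_EFin (measurable_itv `]a, b[) ui (ci c).
apply: (le_trans (le_normr_Rintegral _ di)) => //.
apply: le_Rintegral; [by []|exact: integrable_norm|exact: ci|].
by move=> x /=; rewrite in_itv/=; exact: H.
Qed.

(** The strip has signed width l t - l s and its integrand is nearly constant, so [layer t] is c (l
    t - l s) up to o(l t - l s). *)
Lemma layer_cvg : layer t / (t - s) @[t --> s^'] --> l' s * (u (l s) s * h0 (l s)).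
Proof.
set c := u (l s) s * h0 (l s).
have lq := proj1 (is_derive_quotientP _ _ _) l_deriv.
have key (e : R) : 0 < e -> \forall t \near s^', `|layer t - c * (l t - l s)| <= e * `|l t - l s|.
  move=> e0; have [d d0 Hd] := layer_uniform e0.
  have ls0 := l_pos s_ge0.
  near=> t.
  have t0 : 0 <= t by near: t; apply: dnbhs_future; exact: future_ge0.
  have lt0 := l_pos t0.
  have ld : `|l t - l s| <= d.
    near: t; apply: dnbhs_future; have := proj1 (within_continuousP _ _) l_cont s _ d d0.
    by rewrite /= in_itv/= andbT => /(_ s_ge0); rewrite near_withinE.
  have Hd' : forall x, 0 < x -> `|x - l s| <= d ->
    (x <= l t -> `|u x t * h t x - c| <= e) /\ (x <= l s -> `|u x s * h t x - c| <= e).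
    by near: t; apply: dnbhs_future; exact: Hd.
  move: ld; rewrite ler_norml => /andP[ld1 ld2].
  rewrite /layer; case: (leP (l t) (l s)) => lts.
    rewrite Rintegral_itvoo0 sub0r.
    have -> (I : R) : - I - c * (l t - l s) = - (I - c * (l s - l t)) by ring.
    rewrite normrN (distrC (l t) (l s)) (ger0_norm (_ : 0 <= l s - l t)) ?subr_ge0//.
    apply: strip_estimate => // x /andP[x1 x2]; apply: (Hd' x _ _).2 => //; last exact: ltW.
      exact: lt_trans x1.
    by rewrite ler_norml; apply/andP; split; lra.
  rewrite Rintegral_itvoo0 subr0.
  rewrite (gtr0_norm (_ : 0 < l t - l s)) ?subr_gt0//.
  apply: strip_estimate => //; first exact: ltW.
  move=> x /andP[x1 x2]; apply: (Hd' x _ _).1 => //; last exact: ltW.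
    exact: lt_trans x1.
  by rewrite ler_norml; apply/andP; split; lra.
have cl : c * ((l t - l s) / (t - s)) @[t --> s^'] --> c * l' s.
  by apply: cvgM => //; exact: cvg_cst.
rewrite mulrC; apply/cvgrPdist_le => e e0.
have e2 : 0 < e / 2 by rewrite divr_gt0.
have k0 : 0 < `|l' s| + 1 by rewrite ltr_pwDr.
have e3 : 0 < e / 2 / (`|l' s| + 1) by rewrite divr_gt0.
near=> t.
have ts : t - s != 0 by rewrite subr_eq0; near: t; exact: nbhs_dnbhs_neq.
have A1 : `|c * l' s - c * ((l t - l s) / (t - s))| <= e / 2.
  by near: t; move/cvgrPdist_le : cl; exact.
have A2 : `|l' s - (l t - l s) / (t - s)| <= 1.
  by near: t; move/cvgrPdist_le : lq; exact.
have A3 : `|layer t - c * (l t - l s)| <= e / 2 / (`|l' s| + 1) * `|l t - l s|.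
  by near: t; exact: key.
have A4 : `|(l t - l s) / (t - s)| <= `|l' s| + 1.
  rewrite -(subrK (l' s) (_ / _)) (le_trans (ler_normD _ _))// addrC lerD//.
  by rewrite distrC.
rewrite (_ : _ - layer t / (t - s) = c * l' s - c * ((l t - l s) / (t - s)) -
  (layer t - c * (l t - l s)) / (t - s)); last by ring.
rewrite (le_trans (ler_normB _ _))// (splitr e) lerD// normrM.
apply: (le_trans (ler_wpM2r _ A3)) => //.
rewrite -(mulrA _ `|l t - l s|) -normrM; apply: (le_trans (ler_wpM2l (ltW e3) A4)).
by rewrite divfK// gt_eqF.
Unshelve. all: by end_near. Qed.

(** Leibniz rule on a moving interval for a function differentiable in time only in the L^2 sense.
    The weight is taken at time t in both integrals, so only u and the domain vary. *)
Lemma moving_increment_cvg :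
  (\int[mu]_(x in `]0, l t[) (u x t * h t x) -
   \int[mu]_(x in `]0, l s[) (u x s * h t x)) / (t - s) @[t --> s^'] -->
  \int[mu]_(x in `]0, l s[) (ut x s * h0 x) + l' s * (u (l s) s * h0 (l s)).
Proof.
have H : \int[mu]_(x in `]0, m t[) ((u x t - u x s) / (t - s) * h t x) +
    layer t / (t - s) @[t --> s^'] -->
    \int[mu]_(x in `]0, l s[) (ut x s * h0 x) + l' s * (u (l s) s * h0 (l s)).
  by apply: cvgD; [exact: increment_pairing_cvg|exact: layer_cvg].
apply: cvg_trans H.
apply: near_eq_cvg; near=> t.
have t0 : 0 <= t by near: t; apply: dnbhs_future; exact: future_ge0.
have mt : m t <= l t by rewrite ge_min lexx.
have ms : m t <= l s by rewrite ge_min lexx orbT.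
have m0 : 0 <= m t by rewrite le_min !ltW// l_pos.
rewrite (Rintegral_itv_split m0 mt (u_h_integrable t t0 (lexx 0) (lexx _))).
rewrite (Rintegral_itv_split m0 ms (u_h_integrable t s_ge0 (lexx 0) (lexx _))).
have i1 := u_h_integrable t t0 (lexx 0) mt.
have i2 := u_h_integrable t s_ge0 (lexx 0) ms.
have -> : \int[mu]_(x in `]0, m t[) ((u x t - u x s) / (t - s) * h t x) =
   (\int[mu]_(x in `]0, m t[) (u x t * h t x) -
    \int[mu]_(x in `]0, m t[) (u x s * h t x)) / (t - s).
  rewrite -RintegralB// mulrC -RintegralZl//; last exact: integrableB_EFin.
  by apply: eq_Rintegral => x _; ring.
rewrite /layer; ring.
Unshelve. all: by end_near. Qed.

End moving_increments.

(** * Conservation of the pairing with a reflected wave *)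

Section conservation.
Context {R : realType}.
Local Notation mu := (@lebesgue_measure R).
Local Notation integ D f := (mu.-integrable D (EFin \o f)).
Variables (eta : R) (l l' : R -> R) (u ux ut : R -> R -> R).
Hypothesis l_cont : {within `[0, +oo[, continuous l}.
Hypothesis l_pos : forall t, 0 <= t -> 0 < l t.
Hypothesis l_deriv : has_deriv_on `[0, +oo[ l l'.
Hypothesis l'_cont : {within `[0, +oo[, continuous l'}.
Hypothesis uV : C0_V0 l u ux.
Hypothesis uC : C1_L2 l u ut.
Hypothesis uW : weak_wave eta l l' u ux ut.
Implicit Types (s t x : R).
Variables (Th Th' : R -> R).
Hypothesis ThD : forall t, is_derive t (1 : R) Th (Th' t).
Hypothesis Th'c : continuous Th'.

Local Notation future s := (within (`[0, +oo[%classic : set R) (nbhs s)).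

(** Both combinations solve the wave equation. The odd one vanishes at x = 0, as the weak
    formulation demands of its test functions. *)
Definition oddw (f : R -> R) x t : R := f (t + x) - f (t - x).
Definition evenw (f : R -> R) x t : R := f (t + x) + f (t - x).

Lemma continuous_oddw (f : R -> R) : continuous f ->
  continuous (fun z : R * R => oddw f z.1 z.2).
Proof.
move=> fc z; apply: cvgB.
  by apply: (@continuous_comp _ _ _ (fun z : R * R => z.2 + z.1) f);
    [apply: cvgD; [exact: cvg_snd|exact: cvg_fst]|exact: fc].
by apply: (@continuous_comp _ _ _ (fun z : R * R => z.2 - z.1) f);
  [apply: cvgB; [exact: cvg_snd|exact: cvg_fst]|exact: fc].
Qed.

Lemma continuous_evenw (f : R -> R) : continuous f ->
  continuous (fun z : R * R => evenw f z.1 z.2).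
Proof.
move=> fc z; apply: cvgD.
  by apply: (@continuous_comp _ _ _ (fun z : R * R => z.2 + z.1) f);
    [apply: cvgD; [exact: cvg_snd|exact: cvg_fst]|exact: fc].
by apply: (@continuous_comp _ _ _ (fun z : R * R => z.2 - z.1) f);
  [apply: cvgB; [exact: cvg_snd|exact: cvg_fst]|exact: fc].
Qed.

Lemma is_derive_translate (c t : R) : is_derive t (1 : R) (fun y => Th (y + c)) (Th' (t + c)).
Proof.
have := @is_derive_affine _ Th 1 c t (Th' (t + c)).
rewrite mulr1 mul1r => /(_ (ThD _)).
by under eq_fun do rewrite mul1r.
Qed.

Lemma is_derive_mirror (c t : R) : is_derive t (1 : R) (fun y => Th (c - y)) (- Th' (c - t)).
Proof.
have := @is_derive_affine _ Th (-1) c t (Th' (c - t)).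
rewrite mulrN1 mulN1r addrC => /(_ (ThD _)).
by under eq_fun do rewrite mulN1r addrC.
Qed.

Lemma C1_plane_oddw : C1_plane (oddw Th) (evenw Th') (oddw Th').
Proof.
split.
- move=> x t; have H1 := is_derive_translate t x.
  have := is_deriveB H1 (is_derive_mirror t x).
  rewrite opprK [x + t]addrC.
  by under eq_fun do rewrite [_ + t]addrC.
- move=> x t; exact: is_deriveB (is_derive_translate x t) (is_derive_translate (- x) t).
- exact: continuous_evenw.
- exact: continuous_oddw.
Qed.

Lemma C1_evenw t : C1_on setT ((evenw Th)^~ t) ((oddw Th')^~ t).
Proof.
apply/C1_onTP; split; last by apply: joint_slice; exact: continuous_oddw.
move=> x; have H1 := is_derive_translate t x.
have := is_deriveD H1 (is_derive_mirror t x).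
rewrite [x + t]addrC.
by under eq_fun do rewrite [_ + t]addrC.
Qed.

(** If Phi is a primitive of [Th], then [oddw Th] and [evenw Th] are the t- and x-derivatives of
    [oddw Phi]: this is the energy inner product of u with that wave. *)
Definition wave_pairing t : R :=
  \int[mu]_(x in `]0, l t[) (ut x t * oddw Th x t) +
  \int[mu]_(x in `]0, l t[) (ux x t * evenw Th x t).

Lemma wave_pairing_cvg s : 0 <= s -> wave_pairing t @[t --> future s] --> wave_pairing s.
Proof.
move=> s0; have Thc : continuous Th by move=> x; exact: is_derive_continuous (ThD x).
case: uC => _ utC _; case: uV => _ _ uxC.
apply: cvgD; apply: joint_pairing_cvg => //; [exact: continuous_oddw|exact: continuous_evenw].
Qed.

(** [I1] and [I2] are the interior and boundary integrands in time of [weak_wave] for psi =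
    [oddw Th]. *)
Let I1 t := \int[mu]_(x in `]0, l t[) (ut x t * oddw Th' x t - ux x t * evenw Th' x t).
Let I2 t := u (l t) t * (oddw Th' (l t) t + l' t * evenw Th' (l t) t).

Lemma within_future (f : R -> R) :
  (forall s, 0 <= s -> f t @[t --> future s] --> f s) -> {within `[0, +oo[, continuous f}.
Proof. by move=> H; apply/subspace_continuousP => s; rewrite /= in_itv/= andbT; exact: H. Qed.

Lemma future_within (f : R -> R) s : {within `[0, +oo[, continuous f} -> 0 <= s ->
  f t @[t --> future s] --> f s.
Proof. by move=> /subspace_continuousP H s0; apply: H; rewrite /= in_itv/= andbT. Qed.

Let flux_split t : 0 <= t -> I1 t =
  \int[mu]_(x in `]0, l t[) (ut x t * oddw Th' x t) -
  \int[mu]_(x in `]0, l t[) (ux x t * evenw Th' x t).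
Proof.
move=> t0; case: uC => _ [utL _] _; case: uV => _ _ [uxL _].
have L (f : R -> R -> R) : continuous (fun z : R * R => f z.1 z.2) -> L2 `]0, l t[ (f^~ t).
  by move=> fc; apply: continuous_itv_L2; apply: continuous_subspaceT; exact: joint_slice.
rewrite /I1 RintegralB//; apply: L2_mul => //; do ?[exact: utL|exact: uxL]; apply: L.
- exact: continuous_oddw.
- exact: continuous_evenw.
Qed.

Let flux_cont : {within `[0, +oo[, continuous I1}.
Proof.
apply: within_future => s s0; rewrite flux_split//.
case: uC => _ utC _; case: uV => _ _ uxC.
have H : \int[mu]_(x in `]0, l t[) (ut x t * oddw Th' x t) -
  \int[mu]_(x in `]0, l t[) (ux x t * evenw Th' x t) @[t --> future s] -->
  \int[mu]_(x in `]0, l s[) (ut x s * oddw Th' x s) -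
  \int[mu]_(x in `]0, l s[) (ux x s * evenw Th' x s).
  by apply: cvgB; apply: joint_pairing_cvg => //; [exact: continuous_oddw|exact: continuous_evenw].
apply: cvg_trans H; apply: near_eq_cvg; near=> t; rewrite flux_split//.
by near: t; exact: future_ge0.
Unshelve. all: by end_near. Qed.

Let trace_flux_cont : {within `[0, +oo[, continuous I2}.
Proof.
apply: within_future => s s0.
have lc : l t @[t --> future s] --> l s by exact: future_within.
have idc : t @[t --> future s] --> s by apply: cvg_within_filter; exact: cvg_id.
apply: cvgM; first exact: trace_cvg uV s0.
have comp (g : R -> R) y : g t @[t --> future s] --> y ->
    Th' (g t) @[t --> future s] --> Th' y.
  by move=> H; apply: (continuous_cvg _ _ H); exact: Th'c.
apply: cvgD; last apply: cvgM; [| exact: future_within |].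
- apply: cvgB; apply: comp; [exact: cvgD|exact: cvgB].
- apply: cvgD; apply: comp; [exact: cvgD|exact: cvgB].
Qed.

Let J t := \int[mu]_(x in `]0, l t[) (ut x t * oddw Th x t) +
  eta * (u (l t) t * oddw Th (l t) t).

(** The weak formulation writes J as J 0 plus primitives of [I1] and [I2]; their continuity makes J
    differentiable in the classical sense. *)
Let is_derive_J s : 0 < s -> is_derive s (1 : R) J (I1 s + eta * I2 s).
Proof.
move=> s0.
have D1 := is_derive_primitive flux_cont s0.
have D2 := is_derive_primitive trace_flux_cont s0.
have D3 := is_deriveD (is_derive_cst (J 0) s (1 : R)) (is_deriveD D1 (is_deriveZ eta D2)).
rewrite add0r in D3; apply: is_derive_near_eq D3; near=> T.
have T0 : 0 <= T by rewrite ltW//; near: T; exact: lt_nbhsr.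
have := uW C1_plane_oddw _ T0; rewrite /= => /(_ (fun t => _)) W.
have {}W := W (fun t => _).
have -> : J T = J 0 + (J T - J 0) by rewrite addrC subrK.
rewrite /J W; first by [].
by move=> t; rewrite /oddw addr0 subr0 subrr.
Unshelve. all: by end_near. Qed.

(* The traces of u_t and u_x on the boundary never appear: the only boundary terms
   are increments of t |-> u (l t, t), and the hypothesis cancels their
   coefficient evenw Th - eta oddw Th. *)
Lemma is_derive_wave_pairing s : 0 < s ->
  (\forall t \near s, evenw Th (l t) t = eta * oddw Th (l t) t) ->
  is_derive s (1 : R) wave_pairing 0.
Proof.
move=> s0 adj; apply/is_derive_quotientP.
have s_ge0 := ltW s0.
have sD : nbhs s (`[0, +oo[%classic : set R).
  by apply: filterS (lt_nbhsr s0) => t t0; rewrite /= in_itv/= andbT ltW.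
have ld := has_deriv_on_is_derive sD l_deriv.
have Thc : continuous Th by move=> x; exact: is_derive_continuous (ThD x).
have [_ utC _] := uC; have [_ _ uxC] := uV.
set v := fun t => u (l t) t; set ls := l s.
(* The trace v is only known to be continuous, so outside J its increments must be avoided. [D] lets
   u vary with the weight at time t, and [E] lets the weight vary with u_x frozen at time s. *)
pose D t := (\int[mu]_(x in `]0, l t[) (u x t * oddw Th' x t) -
   \int[mu]_(x in `]0, l s[) (u x s * oddw Th' x t)) / (t - s).
pose E t := \int[mu]_(x in `]0, l s[) (ux x s * ((evenw Th x t - evenw Th x s) / (t - s))).
have cJ := proj1 (is_derive_quotientP _ _ _) (is_derive_J s0).
have dbe : is_derive s (1 : R) (fun t => Th (t + l t)) (Th' (s + ls) * (1 + l' s)).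
  have H := is_deriveD (is_derive_id s (1 : R)) ld.
  exact: (@is_derive1_comp _ Th (fun t => t + l t) s _ _ (ThD _) H).
have dal : is_derive s (1 : R) (fun t => Th (t - l t)) (Th' (s - ls) * (1 - l' s)).
  have H := is_deriveB (is_derive_id s (1 : R)) ld.
  exact: (@is_derive1_comp _ Th (fun t => t - l t) s _ _ (ThD _) H).
have db : is_derive s (1 : R) (fun t => oddw Th (l t) t)
    (Th' (s + ls) * (1 + l' s) - Th' (s - ls) * (1 - l' s)) := is_deriveB dbe dal.
have cb := proj1 (is_derive_quotientP _ _ _) db.
(* The difference between following the moving end point and staying at ls: the time derivatives
   cancel and only the part carried by l' remains. *)
have dc : is_derive s (1 : R) (fun t => evenw Th (l t) t - evenw Th ls t)
    (l' s * oddw Th' ls s).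
  have H := is_deriveB (is_deriveD dbe dal)
    (is_deriveD (is_derive_translate ls s) (is_derive_translate (- ls) s)).
  rewrite (_ : l' s * _ = Th' (s + ls) * (1 + l' s) + Th' (s - ls) * (1 - l' s) -
    (Th' (s + ls) + Th' (s - ls))); first exact: H.
  by rewrite /oddw; ring.
have cc := proj1 (is_derive_quotientP _ _ _) dc.
have cD : D t @[t --> s^'] --> \int[mu]_(x in `]0, l s[) (ut x s * oddw Th' x s) +
    l' s * (v s * oddw Th' ls s).
  apply: (@moving_increment_cvg _ l l' u ux ut s l_cont l_pos uV uC s0 ld
    (fun t x => oddw Th' x t) ((oddw Th')^~ s)).
  - by move=> t; apply: joint_measurable => //; exact: continuous_oddw.
  - by apply: continuous_subspaceT; apply: joint_slice; exact: continuous_oddw.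
  - move=> e e0; rewrite near_withinE.
    apply: filterS (joint_unif 0 (l s + 1) s (continuous_oddw Th'c) e0).
    by move=> t H _ x; exact: H.
  - by move=> t; apply: joint_slice; exact: continuous_oddw.
have uxsL : L2 `]0, l s[ (ux^~ s) by case: uxC => uxL _; exact: uxL.
have [M _ HM] := @joint_bounded R (evenw Th') s 0 (l s) (continuous_evenw Th'c).
have cE : E t @[t --> s^'] --> \int[mu]_(x in `]0, l s[) (ux x s * evenw Th' x s).
  apply: (@pairing_cvg _ _ _ _ _ (fun _ => ux^~ s) _ _ _ M) => //.
  - exact: lty_itv.
  - by near=> t.
  - under eq_fun do under eq_Rintegral do rewrite subrr expr0n.
    rewrite Rintegral_cst// mul0r; exact: cvg_cst.
  - near=> t; apply: measurable_funM => //; apply: measurable_funB.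
      by apply: joint_measurable => //; exact: continuous_evenw.
    by apply: joint_measurable => //; exact: continuous_evenw.
  - by apply: joint_measurable => //; exact: continuous_evenw.
  - by move=> x /= xB; apply: HM; exact: subset_itv_oo_cc xB.
  - move=> e e0; have e2 : 0 < e / 2 by rewrite divr_gt0.
    have := increment_unif (l s) s ThD Th'c e2; rewrite near_withinE.
    apply: filterS => t Ht ts x /=; rewrite in_itv/= => /andP[x0 xl].
    rewrite difference_quotient_le ?subr_eq0//.
    have H1 := Ht x _; have H2 := Ht (- x) _.
    have -> : evenw Th x t - evenw Th x s - evenw Th' x s * (t - s) =
      (Th (t + x) - Th (s + x) - Th' (s + x) * (t - s)) +
      (Th (t - x) - Th (s - x) - Th' (s - x) * (t - s)) by rewrite /evenw; ring.
    rewrite (le_trans (ler_normD _ _))// (splitr e) mulrDl lerD//.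
      by apply: H1; apply/andP; split; lra.
    by apply: H2; apply/andP; split; lra.
(* For t near s this sum is the difference quotient of [wave_pairing]: integration by parts at both
   times brings in the traces, and [adj] absorbs those at time t. *)
have tot : (J t - J s) / (t - s)
   + v s * (((evenw Th (l t) t - evenw Th ls t) - (evenw Th (l s) s - evenw Th ls s)) / (t - s))
   - eta * v s * ((oddw Th (l t) t - oddw Th (l s) s) / (t - s)) - D t + E t @[t --> s^'] -->
   (I1 s + eta * I2 s) + v s * (l' s * oddw Th' ls s) -
   eta * v s * (Th' (s + ls) * (1 + l' s) - Th' (s - ls) * (1 - l' s)) -
   (\int[mu]_(x in `]0, l s[) (ut x s * oddw Th' x s) + l' s * (v s * oddw Th' ls s)) +
   \int[mu]_(x in `]0, l s[) (ux x s * evenw Th' x s).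
  apply: cvgD => //; apply: cvgB => //; apply: cvgB; last by apply: cvgM => //; exact: cvg_cst.
  by apply: cvgD => //; apply: cvgM => //; exact: cvg_cst.
(* [I1 s] cancels against the limits of [D] and [E], [eta * I2 s] against the derivative of
   [oddw Th (l t) t], and the two l' terms against each other. *)
have Z : (I1 s + eta * I2 s) + v s * (l' s * oddw Th' ls s) -
   eta * v s * (Th' (s + ls) * (1 + l' s) - Th' (s - ls) * (1 - l' s)) -
   (\int[mu]_(x in `]0, l s[) (ut x s * oddw Th' x s) + l' s * (v s * oddw Th' ls s)) +
   \int[mu]_(x in `]0, l s[) (ux x s * evenw Th' x s) = 0.
  rewrite flux_split// /I2 /v /ls /oddw /evenw; ring.
rewrite -Z; apply: cvg_trans tot; apply: near_eq_cvg; near=> t.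
have t0 : 0 <= t.
  by rewrite ltW//; near: t; apply: nbhs_dnbhs; exact: lt_nbhsr.
have ts : t - s != 0 by rewrite subr_eq0; near: t; exact: nbhs_dnbhs_neq.
have adjt : evenw Th (l t) t = eta * oddw Th (l t) t by near: t; exact: nbhs_dnbhs.
have [uVt _ _] := uV.
have P1 := weak_deriv_by_parts (l_pos t0) (uVt t t0) (C1_evenw t).
have P2 := weak_deriv_by_parts (l_pos s_ge0) (uVt s s_ge0) (C1_evenw t).
have chiL r : L2 `]0, l s[ ((evenw Th)^~ r).
  by apply: continuous_itv_L2; apply: continuous_subspaceT; apply: joint_slice; exact: continuous_evenw.
have E1 : E t = (\int[mu]_(x in `]0, l s[) (ux x s * evenw Th x t) -
  \int[mu]_(x in `]0, l s[) (ux x s * evenw Th x s)) / (t - s).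
  rewrite -RintegralB//; [|exact: L2_mul..].
  rewrite mulrC -RintegralZl//; last by apply: integrableB_EFin => //; exact: L2_mul.
  by apply: eq_Rintegral => x _; ring.
rewrite E1 P2 /wave_pairing P1 /D /J adjt -/(v t) -/(v s) -/ls.
have -> : evenw Th (l s) s - evenw Th ls s = 0 by rewrite subrr.
by field.
Unshelve. all: by end_near. Qed.

(** Zero derivative on the open interval and continuity up to both ends, which also covers S = 0. *)
Lemma wave_pairing_conserved (S T : R) : 0 <= S -> S <= T ->
  (forall t, S < t < T -> evenw Th (l t) t = eta * oddw Th (l t) t) ->
  wave_pairing T = wave_pairing S.
Proof.
move=> S0 ST adj.
have [||c _] := @MVT_segment _ wave_pairing (cst 0) S T ST.
- move=> t; rewrite in_itv/= => tST; apply: is_derive_wave_pairing.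
    by apply: le_lt_trans S0 _; case/andP: tST.
  have /andP[St tT] := tST; near=> r; apply: adj; apply/andP; split; near: r.
    exact: lt_nbhsr.
  exact: lt_nbhsl.
- apply: continuous_subspaceW (within_future wave_pairing_cvg).
  by apply: subset_itv; rewrite bnd_simp.
- by rewrite /= mul0r => /eqP; rewrite subr_eq0 => /eqP.
Unshelve. all: by end_near. Qed.

End conservation.

(** * Density of C^1 functions *)

Section density.
Context {R : realType}.
Local Notation mu := (@lebesgue_measure R).
Local Notation integ D f := (mu.-integrable D (EFin \o f)).
Implicit Types (f g h : R -> R) (x y t : R).

(** Primitives based at -N and normalised at 0 agree wherever N >= |x|, so they glue to a primitive
    on the whole line. *)
Lemma antiderivative g : continuous g ->
  exists G : R -> R, forall x, is_derive x (1 : R) G (g x).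
Proof.
move=> gc.
have gi a c : integ `]a, c[ g by apply: continuous_itv_integrable; exact: continuous_subspaceT.
pose P N x := \int[mu]_(y in `](- N), x[) g y - \int[mu]_(y in `](- N), 0[) g y.
have PE N N' x : `|x| <= N -> N <= N' -> P N' x = P N x.
  move=> xN NN'; have /andP[x1 x2] : - N <= x <= N by rewrite -ler_norml.
  have n1 : - N' <= - N by rewrite lerN2.
  have n0 : - N <= 0 by rewrite oppr_le0 (le_trans _ xN).
  rewrite /P (Rintegral_itv_split n1 x1 (gi _ _)) (Rintegral_itv_split n1 n0 (gi _ _)).
  by rewrite opprD addrACA subrr add0r.
exists (fun x => P (`|x| + 1) x) => x.
apply: (@is_derive_near_eq _ (P (`|x| + 2))).
  near=> y; apply: PE; first by rewrite lerDl.
  suff : `|y| <= `|x| + 1 by lra.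
  rewrite -(subrK x y) (le_trans (ler_normD _ _))// addrC lerD2l.
  by rewrite distrC; near: y; exact: cvgr_dist_le.
have gw : {within `[- (`|x| + 2), +oo[, continuous g} by exact: continuous_subspaceT.
have Nx : - (`|x| + 2) < x by have := ler_norm (- x); rewrite normrN; lra.
have := is_deriveB (is_derive_primitive gw Nx)
  (is_derive_cst (\int[mu]_(y in `](- (`|x| + 2)), 0[) g y) x (1 : R)).
by rewrite subr0.
Unshelve. all: by end_near. Qed.

Definition clip (M y : R) : R := Num.max (- M) (Num.min M y).

Lemma clip_norm M y : 0 <= M -> `|clip M y| <= M.
Proof.
move=> M0; rewrite /clip /Order.max /Order.min ler_norml.
by case: (ltP M y) => ?; case: ltP => ?; apply/andP; split; lra.
Qed.

Lemma clip_id M y : `|y| <= M -> clip M y = y.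
Proof.
rewrite ler_norml /clip /Order.max /Order.min => /andP[? ?].
by case: (ltP M y) => ?; case: ltP => ?; lra.
Qed.

Lemma clip_lipschitz M x y : `|clip M x - clip M y| <= `|x - y|.
Proof.
wlog xy : x y / x <= y => [H|].
  have [/H//|/ltW/H] := leP x y.
  by rewrite distrC [`|y - x|]distrC.
rewrite [leRHS]distrC [leLHS]distrC (ger0_norm (_ : 0 <= y - x)) ?subr_ge0//.
rewrite /clip /Order.max /Order.min ler_norml.
by case: (ltP M y) => ?; case: (ltP M x) => ?; case: ltP => ?; try case: ltP => ?;
  apply/andP; split; lra.
Qed.

Lemma continuous_clip M : continuous (clip M).
Proof.
move=> x; apply/cvgrPdist_le => e e0; near=> y.
apply: (le_trans (clip_lipschitz M x y)); near: y; exact: cvgr_dist_le.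
Unshelve. all: by end_near. Qed.

Lemma sqr_subr_le (a b c : R) : (a - c) ^+ 2 <= 2 * (a - b) ^+ 2 + 2 * (b - c) ^+ 2.
Proof.
have := sqr_ge0 ((a - b) - (b - c)); nra.
Qed.

Lemma int_sqr_subr_le (D : set R) f g h (e1 e2 : R) : measurable D ->
  L2 D f -> L2 D g -> L2 D h ->
  \int[mu]_(x in D) ((f x - g x) ^+ 2) <= e1 ->
  \int[mu]_(x in D) ((g x - h x) ^+ 2) <= e2 ->
  \int[mu]_(x in D) ((f x - h x) ^+ 2) <= 2 * e1 + 2 * e2.
Proof.
move=> mD fL gL hL H1 H2.
have L := fun f g fL gL => L2_sqr mD (@L2B R D f g mD fL gL).
apply: (@le_trans _ _ (\int[mu]_(x in D) (2 * (f x - g x) ^+ 2 + 2 * (g x - h x) ^+ 2))).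
  apply: le_Rintegral => //; first exact: L.
    by apply: integrableD_EFin => //; apply: integrableZ_EFin => //; exact: L.
  by move=> x _; exact: sqr_subr_le.
rewrite RintegralD//; [|apply: integrableZ_EFin => //; exact: L..].
by rewrite !RintegralZl//; [|exact: L..]; rewrite lerD// ler_pM2l.
Qed.

Lemma clip_L2_approx (D : set R) f (e : R) : measurable D -> L2 D f -> 0 < e ->
  exists2 M, 0 <= M & \int[mu]_(x in D) ((f x - clip M (f x)) ^+ 2) <= e.
Proof.
move=> mD fL e0.
have : \int[mu]_(x in D) ((f x - clip n%:R (f x)) ^+ 2) @[n --> \oo] --> \int[mu]_(x in D) (0 : R).
  apply: (@Rdominated_cvg _ _ _ _ (fun x => f x ^+ 2)) => //.
  - move=> n; apply: measurable_funX; apply: measurable_funB; first exact: L2_meas.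
    apply: (measurableT_comp _ (L2_meas mD fL)).
    by apply: continuous_measurable_fun; exact: continuous_clip.
  - move=> x _; apply: cvg_near_cst; near=> n.
    rewrite clip_id ?subrr ?expr0n//; near: n; exact: nbhs_infty_ger.
  - exact: L2_sqr.
  - move=> n x _; rewrite ger0_norm ?sqr_ge0//.
    have n0 : (0 : R) <= n%:R by [].
    rewrite -(@real_normK _ (_ - _)) ?num_real// -[leRHS](@real_normK _ (f x)) ?num_real//.
    rewrite lerXn2r ?nnegrE//.
    move: (n%:R) n0 => N N0; rewrite /clip /Order.max /Order.min.
    by case: (leP 0 (f x)) => ?; [rewrite [leRHS]ger0_norm//|rewrite [leRHS]ltr0_norm//];
      case: (ltP N (f x)) => ?; case: ltP => ?; rewrite ler_norml; apply/andP; split; lra.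
rewrite Rintegral_cst// mul0r => /cvgrPdist_le/(_ e e0)[N _ HN].
exists N%:R => //; have := HN N (leqnn N).
by rewrite sub0r normrN; apply: le_trans; exact: ler_norm.
Unshelve. all: by end_near. Qed.

(** Density in L^1 is enough for a bounded f: after clipping g at M, the squared error is at most 2
    M |f - g|. *)
Lemma bounded_continuous_approx f (b M e : R) : 0 < e -> 0 <= M ->
  measurable_fun `]0, b[ f -> (forall x, 0 < x < b -> `|f x| <= M) ->
  exists2 g : R -> R, continuous g & \int[mu]_(x in `]0, b[) ((f x - g x) ^+ 2) <= e.
Proof.
move=> e0 M0 mf fM; set D := `]0, b[%classic.
have fM' x : D x -> `|f x| <= M by rewrite /D/= in_itv/=; exact: fM.
have Dy : (mu D < +oo)%E by exact: lty_itv.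
have mD : measurable D by exact: measurable_itv.
have fi : integ D f by exact: (bounded_integrable mD Dy mf fM').
have [g_ [gc gi /fine_cvgP[gfin gcv]]] := approximation_continuous_integrable (measurable_itv `]0, b[) Dy fi.
pose d := e / (2 * M + 1).
have d0 : 0 < d by rewrite divr_gt0// ltr_wpDl// mulr_ge0.
move/cvgrPdist_le : gcv => /(_ d d0) gcv.
near \oo => n.
have Hn : \int[mu]_(x in D) `|f x - g_ n x| <= d.
  have : `|0 - fine (\int[mu]_(z in D) `|(f z - g_ n z)%:E|)%E| <= d by near: n.
  by rewrite sub0r normrN; apply: le_trans; exact: ler_norm.
exists (fun x => clip M (g_ n x)).
  by move=> x; apply: (@continuous_comp _ _ _ (g_ n) (clip M)); [exact: gc|exact: continuous_clip].
have cm : measurable_fun D (fun x => clip M (g_ n x)).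
  apply: measurable_funTS; apply: continuous_measurable_fun => x.
  by apply: (@continuous_comp _ _ _ (g_ n) (clip M)); [exact: gc|exact: continuous_clip].
have fL : L2 D f by apply: bounded_L2 fM'.
have cL : L2 D (fun x => clip M (g_ n x)).
  by apply: (@bounded_L2 _ _ _ M) => // x _; exact: clip_norm.
have di : integ D (fun x => f x - g_ n x) by apply: integrableB_EFin => //; exact: gi.
apply: (@le_trans _ _ (\int[mu]_(x in D) (2 * M * `|f x - g_ n x|))).
  apply: le_Rintegral => //.
  - by apply: L2_sqr => //; exact: L2B.
  - by apply: integrableZ_EFin => //; exact: integrable_norm.
  - move=> x Dx; rewrite -(@real_normK _ (_ - _)) ?num_real// expr2.
    apply: ler_pM => //.
      rewrite (le_trans (ler_normB _ _))// mulr_natl mulr2n lerD//; [exact: fM'|exact: clip_norm].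
    by rewrite -{1}(clip_id (fM' x Dx)); exact: clip_lipschitz.
rewrite RintegralZl//; last exact: integrable_norm.
apply: (le_trans (ler_wpM2l _ Hn)); first by rewrite mulr_ge0.
by rewrite mulrC /d; apply: div_add1_mul_le => //; rewrite mulr_ge0.
Unshelve. all: by end_near. Qed.

(** Steklov averages: h x is the mean of g over [x, x + t] for a small fixed t. *)
Lemma uniform_C1_approx g (b e : R) : 0 < e -> continuous g ->
  exists h h' : R -> R, [/\ forall x, is_derive x (1 : R) h (h' x), continuous h' &
    forall x, 0 <= x <= b -> `|g x - h x| <= e].
Proof.
move=> e0 gc; have [G GD] := antiderivative gc.
have := increment_unif `|b| 0 GD gc e0.
move=> /nbhs_ballP[d /= d0 Hd].
set t := d / 2; have t0 : 0 < t by rewrite divr_gt0.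
have tb : ball (0 : R) d t.
  by rewrite /ball/= sub0r normrN gtr0_norm// /t ltr_pdivrMr// ltr_pMr// ltr1n.
exists (fun x => t^-1 * (G (x + t) - G x)), (fun x => t^-1 * (g (x + t) - g x)); split.
- move=> x; have H : is_derive x (1 : R) (fun y => G (y + t)) (g (x + t)).
    have := @is_derive_affine _ G 1 t x (g (x + t)).
    rewrite mulr1 mul1r => /(_ (GD _)).
    by under eq_fun do rewrite mul1r.
  have := is_deriveZ t^-1 (is_deriveB H (GD x)).
  by rewrite /GRing.scale/=.
- move=> x; apply: cvgM; first exact: cvg_cst.
  apply: cvgB; last exact: gc.
  by apply: (@continuous_comp _ _ _ (fun y : R => y + t) g); [apply: cvgD => //; exact: cvg_cst|exact: gc].
- move=> x /andP[x0 xb]; have bb := ler_norm b.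
  have : - `|b| <= x <= `|b| by apply/andP; split; have := normr_ge0 b; lra.
  move=> /(Hd t tb x); rewrite add0r subr0 => H.
  rewrite (addrC x) distrC mulrC difference_quotient_le// gt_eqF//.
Qed.

(** Cuts a hole of radius r around c and equals 1 at distance 2 r or more. The hole is needed at the
    characteristic where the reflected weight starts. *)
Definition notch (c r x : R) : R := 1 - (ramp (c - 2 * r) r x - ramp (c + r) r x).
Definition dnotch (c r x : R) : R := - (dramp (c - 2 * r) r x - dramp (c + r) r x).

Lemma is_derive_notch c r x : is_derive x (1 : R) (notch c r) (dnotch c r x).
Proof.
have := is_deriveB (is_derive_cst (1 : R) x (1 : R))
  (is_deriveB (is_derive_ramp (c - 2 * r) r x) (is_derive_ramp (c + r) r x)).
by rewrite sub0r.
Qed.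

Lemma continuous_dnotch c r : continuous (dnotch c r).
Proof. by move=> x; apply: cvgN; apply: cvgB; exact: continuous_dramp. Qed.

Lemma notch_in c r x : 0 < r -> `|x - c| <= r -> notch c r x = 0.
Proof.
move=> r0; rewrite ler_norml => /andP[? ?].
by rewrite /notch ramp_hi ?ramp_lo ?subr0 ?subrr//; lra.
Qed.

Lemma notch_out c r x : 0 < r -> 2 * r <= `|x - c| -> notch c r x = 1.
Proof.
move=> r0; rewrite ler_normr => /orP[H|H]; rewrite /notch.
  by rewrite !ramp_hi ?subrr ?subr0//; lra.
by rewrite !ramp_lo ?subrr ?subr0//; lra.
Qed.

Lemma notch_norm c r x : 0 < r -> `|notch c r x| <= 1.
Proof.
move=> r0; rewrite /notch.
have /andP[? ?] := step_ge0_le1 ((x - (c - 2 * r)) / r).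
have /andP[? ?] := step_ge0_le1 ((x - (c + r)) / r).
have [xc|cx] := leP x (c + r).
  rewrite [ramp (c + r) _ _]ramp_lo//; rewrite /ramp.
  by rewrite ler_norml; apply/andP; split; lra.
rewrite [ramp (c - 2 * r) _ _]ramp_hi//; last by lra.
by rewrite /ramp ler_norml; apply/andP; split; lra.
Qed.

Lemma notch_cvg c (r : nat -> R) x : (forall n, 0 < r n) -> r n @[n --> \oo] --> 0 ->
  x != c -> notch c (r n) x @[n --> \oo] --> (1 : R).
Proof.
move=> r0 rc xc; apply: cvg_near_cst; near=> n; apply: notch_out => //.
have : `|0 - r n| <= `|x - c| / 2.
  near: n; move/cvgrPdist_le : rc; apply.
  by rewrite divr_gt0// normr_gt0 subr_eq0.
by rewrite sub0r normrN; have := ler_norm (r n); lra.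
Unshelve. all: by end_near. Qed.

(** Clipping, continuous approximation and averaging give a C^1 function; forcing it to vanish near
    0, b and c then changes the L^2 norm arbitrarily little. *)
Lemma L2_dense_C1 f (b c e : R) : 0 < b -> 0 < e -> L2 `]0, b[ f ->
  exists P P' : R -> R, exists2 r : R, 0 < r &
  [/\ forall x, is_derive x (1 : R) P (P' x), continuous P',
      forall x, x <= r \/ b - r <= x \/ `|x - c| <= r -> P x = 0 &
      \int[mu]_(x in `]0, b[) ((f x - P x) ^+ 2) <= e].
Proof.
move=> b0 e0 fL; set D := `]0, b[%classic.
have mD : measurable D by exact: measurable_itv.
have Dy : (mu D < +oo)%E by exact: lty_itv.
(* Four errors of e / 64 are combined by three uses of (x + y)^2 <= 2 x^2 + 2 y^2; the total is 22 e
   / 64. *)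
have e16 : 0 < e / 64 by rewrite divr_gt0.
have [M M0 H1] := clip_L2_approx mD fL e16.
pose f1 x := clip M (f x).
have f1m : measurable_fun D f1.
  apply: (measurableT_comp _ (L2_meas mD fL)).
  by apply: continuous_measurable_fun; exact: continuous_clip.
have f1L : L2 D f1 by apply: (@bounded_L2 _ _ _ M) => // x _; exact: clip_norm.
have [g gc H2] := bounded_continuous_approx e16 M0 f1m (fun x _ => clip_norm (f x) M0).
have gL : L2 D g by apply: continuous_itv_L2; exact: continuous_subspaceT.
pose q := Num.sqrt (e / 64 / b).
have q0 : 0 < q by rewrite sqrtr_gt0 !divr_gt0.
have [h [h' [hD h'c H3]]] := uniform_C1_approx b q0 gc.
have hc : continuous h by move=> x; exact: is_derive_continuous (hD x).
have hL : L2 D h by apply: continuous_itv_L2; exact: continuous_subspaceT.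
have {}H3 : \int[mu]_(x in D) ((g x - h x) ^+ 2) <= e / 64.
  apply: (@le_trans _ _ (\int[mu]_(x in D) (q ^+ 2))).
    apply: le_Rintegral => //.
    - by apply: L2_sqr => //; exact: L2B.
    - by apply: (@bounded_integrable _ _ _ (q ^+ 2)) => // x _; rewrite ger0_norm ?sqr_ge0.
    - move=> x; rewrite /D/= in_itv/= => /andP[x0 xb].
      rewrite -(@real_normK _ (_ - _)) ?num_real// lerXn2r ?nnegrE//; first exact: ltW.
      by apply: H3; rewrite !ltW.
  rewrite Rintegral_cst// lebesgue_length; last exact: ltW.
  rewrite subr0 sqr_sqrtr; last by rewrite !divr_ge0// ltW.
  by rewrite divfK// gt_eqF.
have A : \int[mu]_(x in D) ((f x - h x) ^+ 2) <= 2 * (2 * (e / 64) + 2 * (e / 64)) + 2 * (e / 64).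
  by apply: (int_sqr_subr_le mD fL gL hL _ H3); exact: (int_sqr_subr_le mD fL f1L gL H1 H2).
pose r n : R := b / 4 / n.+1%:R.
have r0 n : 0 < r n by rewrite !divr_gt0.
have rb n : 4 * r n <= b.
  by rewrite /r mulrA mulrCA divff// mulr1 ler_pdivrMr// ler_peMr ?ler1n// ltW.
have rc : r n @[n --> \oo] --> (0 : R).
  by rewrite -(mulr0 (b / 4)); apply: cvgM; [exact: cvg_cst|exact: cvg_harmonic].
pose C n x := plateau b (r n) x * notch c (r n) x.
have Cc n : continuous (C n).
  move=> x; apply: cvgM; first exact: continuous_plateau.
  exact: is_derive_continuous (is_derive_notch c (r n) x).
have C1 n x : `|C n x| <= 1.
  rewrite normrM -(mulr1 1); apply: ler_pM => //; first exact: norm_plateau.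
  exact: notch_norm.
have CL n : L2 D (fun x => h x * C n x).
  by apply: continuous_itv_L2; apply: continuous_subspaceT => x; apply: cvgM; [exact: hc|exact: Cc].
have Cm n : measurable_fun D (C n) by apply: measurable_funTS; exact: continuous_measurable_fun.
(* Inside (0, b) the cutoffs tend to 1 except at c, where they are eventually 0; the limit is h^2 on
   the null set {c} and the default [point], which is 0, elsewhere. *)
have L : \int[mu]_(x in D) ((h x - h x * C n x) ^+ 2) @[n --> \oo] -->
    \int[mu]_(x in D) (((fun x => h x ^+ 2) \_ [set c]) x).
  apply: (@Rdominated_cvg _ _ _ _ (fun x => 4 * h x ^+ 2)) => //.
  - move=> n; apply: measurable_funX; apply: measurable_funB; first exact: L2_meas.
    exact: L2_meas (CL n).
  - move=> x; rewrite /D/= in_itv/= => /andP[x0 xb].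
    rewrite /patch; case: ifPn => [/set_mem/= ->|].
      apply: cvg_near_cst; near=> n.
      by rewrite /C (notch_in (r0 n)) ?mulr0 ?subr0// subrr normr0 ltW.
    rewrite notin_setE/= => /eqP xc.
    have Cx : C n x @[n --> \oo] --> (1 : R) * 1.
      apply: cvgM; last exact: notch_cvg.
      apply: cvg_near_cst; near=> n; apply: plateau_in => //.
      have : `|0 - r n| <= Num.min (x / 2) ((b - x) / 2).
        near: n; move/cvgrPdist_le : rc; apply.
        by rewrite lt_min !divr_gt0// subr_gt0.
      rewrite sub0r normrN le_min => /andP[? ?]; have := ler_norm (r n).
      by move=> ?; apply/andP; split; lra.
    have -> : point = (h x - h x * (1 * 1)) ^+ 2 :> R by rewrite !mulr1 subrr expr0n.
    have dc : h x - h x * C n x @[n --> \oo] --> h x - h x * (1 * 1).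
      by apply: cvgB; [exact: cvg_cst|apply: cvgM => //; exact: cvg_cst].
    by apply: (cvgM dc dc).
  - by apply: integrableZ_EFin => //; exact: L2_sqr.
  - move=> n x _; rewrite ger0_norm ?sqr_ge0//.
    have := C1 n x; rewrite ler_norml => /andP[? ?].
    have -> : (h x - h x * C n x) ^+ 2 = h x ^+ 2 * (1 - C n x) ^+ 2 by ring.
    by rewrite mulrC ler_wpM2r ?sqr_ge0//; nra.
have Z : \int[mu]_(x in D) (((fun x => h x ^+ 2) \_ [set c]) x) = 0.
  by rewrite -Rintegral_mkcondr Rintegral_mkcondl Rintegral_set1.
rewrite Z in L; move/cvgrPdist_le : L => /(_ _ e16)[n _ /(_ n (leqnn n))].
rewrite /= sub0r normrN => /(le_trans (ler_norm _)) Hn.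
exists (fun x => h x * C n x), (fun x => h' x * C n x + h x *
  (dplateau b (r n) x * notch c (r n) x + plateau b (r n) x * dnotch c (r n) x)).
exists (r n); first exact: r0.
split.
- move=> x.
  have H := is_deriveM (hD x) (is_deriveM (is_derive_plateau b (r n) x) (is_derive_notch c (r n) x)).
  rewrite (_ : h' x * C n x + _ = h x * (plateau b (r n) x * dnotch c (r n) x +
    notch c (r n) x * dplateau b (r n) x) + plateau b (r n) x * notch c (r n) x * h' x).
    exact: H.
  by rewrite /C; ring.
- move=> x; apply: cvgD; first by apply: cvgM; [exact: h'c|exact: Cc].
  apply: cvgM; first exact: hc.
  apply: cvgD; apply: cvgM; [exact: continuous_dplateau| |exact: continuous_plateau|exact: continuous_dnotch].
  exact: is_derive_continuous (is_derive_notch c (r n) x).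
- move=> x [H|[H|H]]; rewrite /C.
  + by rewrite plateau_out ?H// mul0r mulr0.
  + by rewrite plateau_out ?H ?orbT// mul0r mulr0.
  + by rewrite notch_in// !mulr0.
- apply: (le_trans (int_sqr_subr_le mD fL hL (CL n) A Hn)); lra.
Unshelve. all: by end_near. Qed.

End density.

(** * Reflection at the moving end point *)

Section reflection.
Context {R : realType}.
Variables (l l' : R -> R).
Hypothesis l_cont : {within `[0, +oo[, continuous l}.
Hypothesis l_deriv : has_deriv_on `[0, +oo[ l l'.
Hypothesis l'_cont : {within `[0, +oo[, continuous l'}.
Hypothesis l'_lt1 : forall t, 0 <= t -> `|l' t| < 1.
Implicit Types (s t x y : R).

(** The values of t - x and t + x at the moving end point. Since |l'| < 1 both are strictly
    increasing, so a characteristic meets the end point at most once. *)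
Definition char_left t : R := t - l t.
Definition char_right t : R := t + l t.

Lemma l_is_derive t : 0 < t -> is_derive t (1 : R) l (l' t).
Proof.
move=> t0; apply: has_deriv_on_is_derive l_deriv.
by apply: filterS (lt_nbhsr t0) => x x0; rewrite /= in_itv/= andbT ltW.
Qed.

Lemma char_left_is_derive t : 0 < t -> is_derive t (1 : R) char_left (1 - l' t).
Proof. by move=> /l_is_derive; exact: is_deriveB (is_derive_id t (1 : R)). Qed.

Lemma char_right_is_derive t : 0 < t -> is_derive t (1 : R) char_right (1 + l' t).
Proof. by move=> /l_is_derive; exact: is_deriveD (is_derive_id t (1 : R)). Qed.

Lemma within_sub (D : set R) (f g : R -> R) : {within D, continuous f} ->
  {within D, continuous g} -> {within D, continuous (fun x => f x - g x)}.
Proof. by move=> fc gc x; apply: cvgB; [exact: fc|exact: gc]. Qed.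

Lemma within_add (D : set R) (f g : R -> R) : {within D, continuous f} ->
  {within D, continuous g} -> {within D, continuous (fun x => f x + g x)}.
Proof. by move=> fc gc x; apply: cvgD; [exact: fc|exact: gc]. Qed.

Lemma within_comp (D : set R) (f g : R -> R) : continuous g ->
  {within D, continuous f} -> {within D, continuous (fun x => g (f x))}.
Proof. by move=> gc fc x; apply: continuous_comp; [exact: fc|exact: gc]. Qed.

Lemma char_left_within : {within `[0, +oo[, continuous char_left}.
Proof. by apply: within_sub => //; apply: continuous_subspaceT => x; exact: cvg_id. Qed.

Lemma char_right_within : {within `[0, +oo[, continuous char_right}.
Proof. by apply: within_add => //; apply: continuous_subspaceT => x; exact: cvg_id. Qed.

Lemma increasing_pos_derive (f f' : R -> R) : {within `[0, +oo[, continuous f} ->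
  (forall t, 0 < t -> is_derive t (1 : R) f (f' t)) ->
  (forall t, 0 < t -> 0 < f' t) -> forall s t, 0 <= s -> s < t -> f s < f t.
Proof.
move=> fc fD f'0 s t s0 st.
have [||c] := @MVT _ f f' s t st _ (continuous_subspaceW _ fc).
- by move=> x; rewrite in_itv/= => /andP[sx _]; apply: fD; exact: le_lt_trans sx.
- by apply: subset_itv; rewrite bnd_simp.
rewrite in_itv/= => /andP[sc _] E.
by rewrite -subr_gt0 E mulr_gt0 ?subr_gt0// f'0// (le_lt_trans s0 sc).
Qed.

Lemma char_left_increasing s t : 0 <= s -> s < t -> char_left s < char_left t.
Proof.
apply: (increasing_pos_derive char_left_within char_left_is_derive) => r r0.
by have := l'_lt1 (ltW r0); rewrite ltr_norml => /andP[_ ?]; lra.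
Qed.

Lemma char_right_increasing s t : 0 <= s -> s < t -> char_right s < char_right t.
Proof.
apply: (increasing_pos_derive char_right_within char_right_is_derive) => r r0.
by have := l'_lt1 (ltW r0); rewrite ltr_norml => /andP[? _]; lra.
Qed.

Definition inv_al y : R := xget 0 [set t | 0 <= t /\ char_left t = y].

Lemma al_inj s t : 0 <= s -> 0 <= t -> char_left s = char_left t -> s = t.
Proof.
move=> s0 t0 E; apply/eqP; rewrite eq_le !leNgt; apply/andP; split; apply/negP => H.
  by have := char_left_increasing t0 H; rewrite E ltxx.
by have := char_left_increasing s0 H; rewrite E ltxx.
Qed.

Lemma inv_alK t : 0 <= t -> inv_al (char_left t) = t.
Proof.
move=> t0; have [[r0 E]] : [set r | 0 <= r /\ char_left r = char_left t] (inv_al (char_left t)).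
  by apply: (@xgetPex _ _ [set r | 0 <= r /\ char_left r = char_left t]); exists t.
exact: al_inj.
Qed.

Lemma inv_al_onto S T y : 0 <= S -> S <= T -> char_left S <= y <= char_left T ->
  exists2 t, S <= t <= T & char_left t = y.
Proof.
move=> S0 ST /andP[Sy yT].
have ac : {within `[S, T], continuous char_left}.
  by apply: continuous_subspaceW char_left_within; apply: subset_itv; rewrite bnd_simp.
have [|c cST <-] := IVT ST ac (v := y).
  by rewrite ge_min le_max Sy yT orbT.
by exists c.
Qed.

Lemma inv_al_is_derive t : 0 < t -> is_derive (char_left t) (1 : R) inv_al (1 - l' t)^-1.
Proof.
move=> t0; apply: is_derive_inverse; last 2 first.
- exact: char_left_is_derive.
- have := l'_lt1 (ltW t0); rewrite ltr_norml => /andP[_ ?].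
  by rewrite gt_eqF// subr_gt0.
- by near=> r; apply: inv_alK; rewrite ltW//; near: r; exact: lt_nbhsr.
- near=> r; apply: (is_derive_continuous (char_left_is_derive _)); near: r; exact: lt_nbhsr.
Unshelve. all: by end_near. Qed.

Lemma l'_continuous t : 0 < t -> {for t, continuous l'}.
Proof.
move=> t0; apply/cvgrPdist_le => e e0.
have := proj1 (within_continuousP _ _) l'_cont t _ e e0.
rewrite /= in_itv/= andbT => /(_ (ltW t0)); apply: filterS2 (lt_nbhsr t0) => s s0 Hs.
by rewrite distrC; apply: Hs; rewrite in_itv/= andbT ltW.
Qed.

Variables (om om' : R -> R) (g r S T : R).
Hypothesis omD : forall x, is_derive x (1 : R) om (om' x).
Hypothesis om'c : continuous om'.
Hypothesis r0 : 0 < r.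
Hypothesis S0 : 0 <= S.
Hypothesis ST : S < T.
Hypothesis omS : forall y, `|y - char_right S| <= r -> om y = 0.
Hypothesis omT : forall y, char_right T - r <= y -> om y = 0.

(** The rule z (t - l t) = g om (t + l t) solved for z at y = t - l t. In [zeta'] the factor 1 + l'
    comes from [char_right] and 1 / (1 - l') from the inverse of [char_left]. *)
Let zeta y : R := if (char_left S < y) && (y < char_left T) then
  g * om (char_right (inv_al y)) else 0.
Let zeta' y : R := if (char_left S < y) && (y < char_left T) then
  g * (om' (char_right (inv_al y)) * (1 + l' (inv_al y)) / (1 - l' (inv_al y))) else 0.

Let om'_zero (U : set R) y : nbhs y U -> (forall x, U x -> om x = 0) -> om' y = 0.
Proof.
move=> Uy U0; have [_ <-] := omD y.
suff : is_derive y (1 : R) om 0 by case.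
have := is_derive_cst (0 : R) y (1 : R); apply: is_derive_near_eq.
by apply: filterS Uy => x /U0 ->.
Qed.

Let om'S y : `|y - char_right S| < r -> om' y = 0.
Proof.
move=> yr; apply: (@om'_zero [set x | `|x - char_right S| < r]); last by move=> x /ltW/omS.
apply/nbhs_ballP; exists (r - `|y - char_right S|); first by rewrite /= subr_gt0.
move=> x; rewrite /ball/= distrC ltrBrDr; apply: le_lt_trans.
exact: ler_distD.
Qed.

Let om'T y : char_right T - r < y -> om' y = 0.
Proof.
move=> yr; apply: (@om'_zero [set x | char_right T - r < x]); last by move=> x /ltW/omT.
exact: lt_nbhsr.
Qed.

Let near_start : exists2 t1, S < t1 & char_right t1 < char_right S + r.
Proof.
have := proj1 (within_continuousP _ _) char_right_within S _ (r / 2).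
rewrite /= in_itv/= andbT S0 divr_gt0// => /(_ isT isT)/nbhs_ballP[d /= d0 Hd].
exists (S + d / 2); first by rewrite ltrDl divr_gt0.
have := Hd (S + d / 2); rewrite /ball/= opprD addNKr normrN gtr0_norm ?divr_gt0//.
rewrite ltr_pdivrMr// ltr_pMr// ltr1n => /(_ isT).
rewrite in_itv/= andbT addr_ge0 ?divr_ge0// ?(ltW d0)// => /(_ isT).
rewrite ler_distl => /andP[_ H]; apply: (le_lt_trans H).
by rewrite ltrD2l ltr_pdivrMr// ltr_pMr// ltr1n.
Qed.

Let near_end : exists2 t2, 0 <= t2 < T & char_right T - r < char_right t2.
Proof.
have T0 : 0 < T by exact: le_lt_trans ST.
have := proj1 (within_continuousP _ _) char_right_within T _ (r / 2).
rewrite /= in_itv/= andbT (ltW T0) divr_gt0// => /(_ isT isT)/nbhs_ballP[d /= d0 Hd].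
pose t2 := Num.max (T / 2) (T - d / 2).
have t2T : t2 < T by rewrite gt_max; apply/andP; split; lra.
have t20 : 0 <= t2 by rewrite le_max divr_ge0// ltW.
exists t2; first by rewrite t20.
have := Hd t2; rewrite /ball/= gtr0_norm ?subr_gt0//.
have t2d : T - d / 2 <= t2 by rewrite le_max lexx orbT.
have -> : T - t2 < d by lra.
move=> /(_ isT); rewrite in_itv/= andbT t20 => /(_ isT).
rewrite ler_distl => /andP[H _]; apply: lt_le_trans H.
by rewrite ltrD2l ltrN2 ltr_pdivrMr// ltr_pMr// ltr1n.
Qed.

Let inv_in y : char_left S < y -> y < char_left T ->
  [/\ S < inv_al y, inv_al y < T & char_left (inv_al y) = y].
Proof.
move=> Sy yT; have [|t /andP[St tT] ty] := @inv_al_onto S T y S0 (ltW ST).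
  by rewrite !ltW.
have t0 : 0 <= t by exact: le_trans St.
have T0 : 0 <= T by exact: le_trans tT.
rewrite -ty inv_alK//; split => //.
- by rewrite lt_neqAle St andbT; apply: contraTneq Sy => ->; rewrite ty ltxx.
- by rewrite lt_neqAle tT andbT; apply: contraTneq yT => <-; rewrite ty ltxx.
Qed.

(** Just after time S the right characteristic is still within r of its value at S, where om and om'
    vanish, so the cutoff at [char_left S] creates no jump. *)
Let zeta_start : exists2 y1, char_left S < y1 & forall y, y < y1 -> zeta y = 0 /\ zeta' y = 0.
Proof.
have [t1 St1 bt1] := near_start.
exists (char_left t1); first exact: char_left_increasing.
move=> y yt1; rewrite /zeta /zeta'; case: ifP => // /andP[Sy yT].
have [Si iT iy] := inv_in Sy yT; set t := inv_al y in Si iT iy *.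
have t0 : 0 <= t by rewrite ltW// (le_lt_trans S0).
have tt1 : t < t1.
  rewrite ltNge; apply/negP; rewrite le_eqVlt => /predU1P[E|H].
    by move: yt1; rewrite -iy E ltxx.
  have := char_left_increasing (le_trans S0 (ltW St1)) H.
  by rewrite iy => /(lt_trans yt1); rewrite ltxx.
have b1 := char_right_increasing S0 Si; have b2 := char_right_increasing t0 tt1.
have H : `|char_right t - char_right S| < r by rewrite ltr_norml; apply/andP; split; lra.
by rewrite omS ?ltW// om'S// !mul0r !mulr0.
Qed.

Let zeta_end : exists2 y2, y2 < char_left T & forall y, y2 < y -> zeta y = 0 /\ zeta' y = 0.
Proof.
have [t2 /andP[t20 t2T] bt2] := near_end.
exists (char_left t2); first exact: char_left_increasing.
move=> y yt2; rewrite /zeta /zeta'; case: ifP => // /andP[Sy yT].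
have [Si iT iy] := inv_in Sy yT; set t := inv_al y in Si iT iy *.
have t0 : 0 <= t by rewrite ltW// (le_lt_trans S0).
have tt2 : t2 < t.
  rewrite ltNge; apply/negP; rewrite le_eqVlt => /predU1P[E|H].
    by move: yt2; rewrite -iy E ltxx.
  have := char_left_increasing t0 H.
  by rewrite iy => /(lt_trans yt2); rewrite ltxx.
have b2 := char_right_increasing t20 tt2.
have H : char_right T - r < char_right t by exact: lt_trans b2.
by rewrite omT ?ltW// om'T// !mul0r !mulr0.
Qed.

Let zeta_mid y : char_left S < y -> y < char_left T ->
  is_derive y (1 : R) zeta (zeta' y) /\ {for y, continuous zeta'}.
Proof.
move=> Sy yT; have [Si iT iy] := inv_in Sy yT.
have i0 : 0 < inv_al y by exact: le_lt_trans Si.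
have dI := inv_al_is_derive i0; rewrite iy in dI.
have mid : \forall x \near y, (char_left S < x) && (x < char_left T).
  by near=> x; apply/andP; split; near: x; [exact: lt_nbhsr|exact: lt_nbhsl].
have cI := is_derive_continuous dI.
split.
  have d1 := @is_derive1_comp _ char_right inv_al y _ _ (char_right_is_derive i0) dI.
  have d2 := @is_derive1_comp _ om (char_right \o inv_al) y _ _ (omD _) d1.
  have d3 := is_deriveZ g d2.
  apply: (@is_derive_near_eq _ (fun x => g * om (char_right (inv_al x)))).
    by apply: filterS mid => x xm; rewrite /zeta xm.
  rewrite /zeta' Sy yT /= -mulrA; exact: d3.
have cb : {for inv_al y, continuous char_right} by exact: is_derive_continuous (char_right_is_derive i0).
have H : (fun x => g * (om' (char_right (inv_al x)) * (1 + l' (inv_al x)) / (1 - l' (inv_al x)))) @ y -->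
   g * (om' (char_right (inv_al y)) * (1 + l' (inv_al y)) / (1 - l' (inv_al y))).
  have cl : l' (inv_al x) @[x --> y] --> l' (inv_al y).
    by apply: (continuous_cvg _ _ cI); exact: l'_continuous.
  have co : om' (char_right (inv_al x)) @[x --> y] --> om' (char_right (inv_al y)).
    have cbe : char_right (inv_al x) @[x --> y] --> char_right (inv_al y) by exact: (continuous_cvg _ _ cI).
    by apply: (continuous_cvg _ _ cbe); exact: om'c.
  apply: cvgM; first exact: cvg_cst.
  apply: cvgM; first by apply: cvgM => //; apply: cvgD => //; exact: cvg_cst.
  apply: cvgV; last by apply: cvgB => //; exact: cvg_cst.
  have := l'_lt1 (ltW i0); rewrite ltr_norml => /andP[_ ?].
  by rewrite gt_eqF// subr_gt0.
have zy : zeta' y = g * (om' (char_right (inv_al y)) * (1 + l' (inv_al y)) / (1 - l' (inv_al y))).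
  by rewrite /zeta' Sy yT.
suff : zeta' x @[x --> y] --> zeta' y by [].
rewrite zy; apply: cvg_trans H; apply: near_eq_cvg.
by apply: filterS mid => x xm; rewrite /zeta' xm.
Unshelve. all: by end_near. Qed.

Let zeta_zero (U : set R) y : nbhs y U -> (forall x, U x -> zeta x = 0 /\ zeta' x = 0) ->
  is_derive y (1 : R) zeta (zeta' y) /\ {for y, continuous zeta'}.
Proof.
move=> Uy U0; have [_ zy] := U0 y (nbhs_singleton Uy); split.
  rewrite zy; have := is_derive_cst (0 : R) y (1 : R); apply: is_derive_near_eq.
  by apply: filterS Uy => x /U0[->].
suff : zeta' x @[x --> y] --> zeta' y by [].
rewrite zy; apply: cvg_near_cst.
by apply: filterS Uy => x /U0[_ ->].
Qed.

(* zeta is the outgoing part of the weight dual to the incoming part om. It is C^1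
   because om vanishes near the two end points where zeta is cut off. *)
Lemma reflection : exists z z' : R -> R,
  [/\ forall y, is_derive y (1 : R) z (z' y), continuous z',
      forall t, S <= t <= T -> z (char_left t) = g * om (char_right t) &
      forall y, ~~ (char_left S < y < char_left T) -> z y = 0].
Proof.
have [y1 Sy1 H1] := zeta_start; have [y2 y2T H2] := zeta_end.
have all y : is_derive y (1 : R) zeta (zeta' y) /\ {for y, continuous zeta'}.
  have [yS|Sy] := leP y (char_left S).
    apply: (@zeta_zero [set x | x < y1]); last exact: H1.
    by apply: lt_nbhsl; exact: le_lt_trans Sy1.
  have [Ty|yT] := leP (char_left T) y; last exact: zeta_mid.
  apply: (@zeta_zero [set x | y2 < x]); last exact: H2.
  by apply: lt_nbhsr; exact: lt_le_trans Ty.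
exists zeta, zeta'; split.
- by move=> y; case: (all y).
- by move=> y; case: (all y).
- move=> t /andP[St tT]; have t0 : 0 <= t by exact: le_trans St.
  rewrite /zeta; case: ifPn => [_|]; first by rewrite inv_alK.
  (* Only t = S and t = T fall outside the open range; there both sides are 0 because om
     vanishes. *)
  rewrite negb_and -!leNgt => /orP[H|H].
    have -> : t = S.
      apply/eqP; rewrite eq_le St andbT leNgt; apply/negP => /(char_left_increasing S0).
      by rewrite ltNge H.
    by rewrite omS ?mulr0// subrr normr0 ltW.
  have -> : t = T.
    apply/eqP; rewrite eq_le tT /= leNgt; apply/negP => /(char_left_increasing t0).
    by rewrite ltNge H.
  by rewrite omT ?mulr0// gerBl ltW.
- by move=> y /negbTE H; rewrite /zeta H.
Qed.

End reflection.

(** * Decay of the energy *)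

Section energy_decay.
Context {R : realType}.
Local Notation mu := (@lebesgue_measure R).
Local Notation integ D f := (mu.-integrable D (EFin \o f)).
Variables (eta : R) (l l' : R -> R) (u ux ut : R -> R -> R).
Hypothesis eta0 : 0 < eta.
Hypothesis l_cont : {within `[0, +oo[, continuous l}.
Hypothesis l_pos : forall t, 0 <= t -> 0 < l t.
Hypothesis l_deriv : has_deriv_on `[0, +oo[ l l'.
Hypothesis l'_cont : {within `[0, +oo[, continuous l'}.
Hypothesis l'_lt1 : forall t, 0 <= t -> `|l' t| < 1.
Hypothesis uV : C0_V0 l u ux.
Hypothesis uC : C1_L2 l u ut.
Hypothesis uW : weak_wave eta l l' u ux ut.
Implicit Types (s t x y : R).

Local Notation al := (char_left l).
Local Notation be := (char_right l).
(** Solving [evenw Th = eta * oddw Th] at the end point for Th (t - l t) gives this multiple of Th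
    (t + l t). *)
Definition reflection_coef : R := (eta - 1) / (eta + 1).
Local Notation gam := reflection_coef.

Let utL t : 0 <= t -> L2 `]0, l t[ (ut^~ t).
Proof. by move=> t0; case: uC => _ [H _] _; exact: H. Qed.

Let uxL t : 0 <= t -> L2 `]0, l t[ (ux^~ t).
Proof. by move=> t0; case: uV => _ _ [H _]; exact: H. Qed.

Let continuous_L2 (f : R -> R) b : continuous f -> L2 `]0, b[ f.
Proof. by move=> fc; apply: continuous_itv_L2; exact: continuous_subspaceT. Qed.

Let pp t x : R := (ut x t + ux x t) / 2.
Let qq t x : R := (ux x t - ut x t) / 2.

Let ppL t : 0 <= t -> L2 `]0, l t[ (pp t).
Proof.
move=> t0; apply: (@L2_ext _ _ (fun x => 2^-1 * (ut x t + ux x t))) => //.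
  by move=> x _; rewrite mulrC.
by apply: L2Z => //; apply: L2D => //; [exact: utL|exact: uxL].
Qed.

Let qqL t : 0 <= t -> L2 `]0, l t[ (qq t).
Proof.
move=> t0; apply: (@L2_ext _ _ (fun x => 2^-1 * (ux x t - ut x t))) => //.
  by move=> x _; rewrite mulrC.
by apply: L2Z => //; apply: L2B => //; [exact: uxL|exact: utL].
Qed.

Variables (Th Th' : R -> R).
Hypothesis ThD : forall t, is_derive t (1 : R) Th (Th' t).
Hypothesis Th'c : continuous Th'.

Let Thc : continuous Th. Proof. by move=> x; exact: is_derive_continuous (ThD x). Qed.

Let shiftc t : continuous (fun x => Th (t + x)).
Proof.
by move=> x; apply: (@continuous_comp _ _ _ (fun y : R => t + y) Th);
  [apply: cvgD; [exact: cvg_cst|exact: cvg_id]|exact: Thc].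
Qed.

Let reflc t : continuous (fun x => Th (t - x)).
Proof.
by move=> x; apply: (@continuous_comp _ _ _ (fun y : R => t - y) Th);
  [apply: cvgB; [exact: cvg_cst|exact: cvg_id]|exact: Thc].
Qed.

Let shiftL t b : L2 `]0, b[ (fun x => Th (t + x)). Proof. by apply: continuous_L2; exact: shiftc. Qed.
Let reflL t b : L2 `]0, b[ (fun x => Th (t - x)). Proof. by apply: continuous_L2; exact: reflc. Qed.

Definition weight_energy t : R :=
  \int[mu]_(x in `]0, l t[) (Th (t + x) ^+ 2 + Th (t - x) ^+ 2).

(** Squared L^2 distance between [Th] and half of the travelling profile of u over
    [t - l t, t + l t]. *)
Definition mismatch t : R :=
  \int[mu]_(x in `]0, l t[) ((pp t x - Th (t + x)) ^+ 2) +
  \int[mu]_(x in `]0, l t[) ((qq t x - Th (t - x)) ^+ 2).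

(* With p = (u_t + u_x) / 2 and q = (u_x - u_t) / 2 the pairing is
   2 (p, Th (t + x)) + 2 (q, Th (t - x)), and the energy is p^2 + q^2. *)
Lemma wave_pairing_split t : 0 <= t ->
  wave_pairing l ux ut Th t = energy l ux ut t + weight_energy t - mismatch t.
Proof.
move=> t0; have pL := ppL t0; have qL := qqL t0.
have sL := shiftL t (l t); have rL := reflL t (l t).
have mI : measurable `]0, l t[%classic by exact: measurable_itv.
have oL : L2 `]0, l t[ ((oddw Th)^~ t) by exact: L2B.
have eL : L2 `]0, l t[ ((evenw Th)^~ t) by exact: L2D.
have i1 := L2_mul mI (utL t0) oL; have i2 := L2_mul mI (uxL t0) eL.
have i3 := L2_sqr mI (L2B mI pL sL); have i4 := L2_sqr mI (L2B mI qL rL).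
have i5 := integrableD_EFin mI (L2_sqr mI (utL t0)) (L2_sqr mI (uxL t0)).
have i6 := integrableD_EFin mI (L2_sqr mI sL) (L2_sqr mI rL).
apply/eqP; rewrite eq_sym subr_eq eq_sym; apply/eqP.
rewrite /mismatch /weight_energy /energy /wave_pairing.
have i12 := integrableD_EFin mI i1 i2; have i34 := integrableD_EFin mI i3 i4.
have i5' := integrableZ_EFin 2^-1 mI i5.
rewrite -(RintegralD _ i1 i2)// -(RintegralD _ i3 i4)// -(RintegralD _ i12 i34)//.
rewrite -(RintegralZl _ _ i5)// -(RintegralD _ i5' i6)//.
by apply: eq_Rintegral => x _; rewrite /pp /qq /oddw /evenw; field.
Qed.

Variables (S T : R).
Hypothesis S0 : 0 <= S.
Hypothesis ST : S < T.
Hypothesis Th_refl : forall t, S < t < T -> Th (al t) = gam * Th (be t).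
Hypothesis slow : forall t, S < t < T -> gam ^+ 2 * (1 - l' t) <= 1 + l' t.

(** With G a primitive of Th^2 the weight energy is G (t + l t) - G (t - l t). By the reflection
    rule its derivative is Th (t + l t)^2 ((1 + l') - gam^2 (1 - l')), nonnegative by [slow]. *)
Lemma weight_energy_le : weight_energy S <= weight_energy T.
Proof.
have sqc : continuous (fun x => Th x ^+ 2) by move=> x; apply: cvgM; exact: Thc.
have [G GD] := antiderivative sqc.
have Gc : continuous G by move=> x; exact: is_derive_continuous (GD x).
have wE t : 0 <= t -> weight_energy t = G (be t) - G (al t).
  move=> t0; have H x : is_derive x (1 : R) (fun y => G (t + y) - G (t - y))
     (Th (t + x) ^+ 2 + Th (t - x) ^+ 2).
    have := is_deriveB (@is_derive_translate _ G (fun y => Th y ^+ 2) GD t x)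
      (@is_derive_mirror _ G (fun y => Th y ^+ 2) GD t x).
    rewrite opprK [x + t]addrC.
    by under eq_fun do rewrite [_ + t]addrC.
  rewrite /weight_energy (FTC (ltW (l_pos t0)) H); last first.
    by move=> x; apply: cvgD; apply: cvgM; do ?[exact: shiftc|exact: reflc].
  by rewrite addr0 subr0 subrr subr0.
have T0 : 0 <= T by rewrite ltW// (le_lt_trans S0).
rewrite !wE//.
have [||c] := @MVT _ (fun t => G (be t) - G (al t))
   (fun t => Th (be t) ^+ 2 * (1 + l' t) - Th (al t) ^+ 2 * (1 - l' t)) S T ST.
- move=> t; rewrite in_itv/= => /andP[St _].
  have t0 : 0 < t by exact: le_lt_trans St.
  have d1 := @is_derive1_comp _ G be t _ _ (GD _) (char_right_is_derive l_deriv t0).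
  have d2 := @is_derive1_comp _ G al t _ _ (GD _) (char_left_is_derive l_deriv t0).
  exact: is_deriveB d1 d2.
- have sub : `[S, T]%classic `<=` (`[0, +oo[%classic : set R).
    by apply: subset_itv; rewrite bnd_simp.
  apply: within_sub.
  + apply: within_comp => //; exact: (continuous_subspaceW sub (char_right_within l_cont)).
  + apply: within_comp => //; exact: (continuous_subspaceW sub (char_left_within l_cont)).
rewrite in_itv/= => cST E; rewrite -subr_ge0 E mulr_ge0 ?subr_ge0 ?(ltW ST)//.
rewrite Th_refl// exprMn; have := slow cST; have := sqr_ge0 (Th (be c)); nra.
Qed.

(** [mismatch S] is dropped by its sign; [mismatch T] remains as the price of an imperfect choice of
    [Th]. *)
Lemma energy_le_mismatch : energy l ux ut T <= energy l ux ut S + mismatch T.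
Proof.
have T0 : 0 <= T by rewrite ltW// (le_lt_trans S0).
have := wave_pairing_conserved l_cont l_pos l_deriv l'_cont uV uC uW ThD Th'c S0 (ltW ST).
have e1 : eta + 1 != 0 by rewrite gt_eqF// addr_gt0.
move=> H; have {}H : wave_pairing l ux ut Th T = wave_pairing l ux ut Th S.
  apply: H => t tST; rewrite /evenw /oddw -/(be t) -/(al t) Th_refl//.
  by rewrite /reflection_coef; field.
move: H; rewrite !wave_pairing_split// => H.
have W := weight_energy_le.
have M : 0 <= mismatch S.
  by apply: addr_ge0; apply: Rintegral_ge0 => x _; exact: sqr_ge0.
lra.
Qed.

End energy_decay.

(** * Choice of the weight and iteration over short time steps *)

Section energy_monotone.
Context {R : realType}.
Local Notation mu := (@lebesgue_measure R).
Variables (eta : R) (l l' : R -> R) (u ux ut : R -> R -> R).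
Hypothesis eta0 : 0 < eta.
Hypothesis l_cont : {within `[0, +oo[, continuous l}.
Hypothesis l_pos : forall t, 0 <= t -> 0 < l t.
Hypothesis l_deriv : has_deriv_on `[0, +oo[ l l'.
Hypothesis l'_cont : {within `[0, +oo[, continuous l'}.
Hypothesis l'_lt1 : forall t, 0 <= t -> `|l' t| < 1.
Hypothesis uV : C0_V0 l u ux.
Hypothesis uC : C1_L2 l u ut.
Hypothesis uW : weak_wave eta l l' u ux ut.
Implicit Types (s t x y : R).
Local Notation al := (char_left l).
Local Notation be := (char_right l).
Local Notation gam := (reflection_coef eta).

(** The condition [al T <= be S] keeps reflected values of the weight from reaching the right end
    point again before T, so prescribing [Th] at time T and reflecting once is consistent. *)
Lemma energy_step S T : 0 <= S -> S < T -> al T <= be S ->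
  (forall t, S < t < T -> gam ^+ 2 * (1 - l' t) <= 1 + l' t) ->
  energy l ux ut T <= energy l ux ut S.
Proof.
move=> S0 ST aTbS slow; apply/ler_addgt0Pr => e e0.
have T0 : 0 <= T by rewrite ltW// (le_lt_trans S0).
have lT := l_pos T0.
have e2 : 0 < e / 2 by rewrite divr_gt0.
have utL : L2 `]0, l T[ (ut^~ T) by case: uC => _ [H _] _; exact: H.
have uxL : L2 `]0, l T[ (ux^~ T) by case: uV => _ _ [H _]; exact: H.
have pL : L2 `]0, l T[ (fun x => (ut x T + ux x T) / 2).
  apply: (@L2_ext _ _ (fun x => 2^-1 * (ut x T + ux x T))) => //.
    by move=> x _; rewrite mulrC.
  by apply: L2Z => //; exact: L2D.
have qL : L2 `]0, l T[ (fun x => (ux x T - ut x T) / 2).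
  apply: (@L2_ext _ _ (fun x => 2^-1 * (ux x T - ut x T))) => //.
    by move=> x _; rewrite mulrC.
  by apply: L2Z => //; exact: L2B.
(* Position of [be S] relative to T, in the variable x of T + x; it becomes -k in the variable of T
   - x. The holes of P and Q are placed there. *)
pose k := be S - T.
have [P [P' [rP rP0 [PD P'c Pz Pe]]]] := L2_dense_C1 k lT e2 pL.
have [Q [Q' [rQ rQ0 [QD Q'c Qz Qe]]]] := L2_dense_C1 (- k) lT e2 qL.
(* P lives in x > 0 and Q in T - y > 0, so the sum glues the two halves of the target profile into
   one function supported in (al T, be T). *)
pose om y := P (y - T) + Q (T - y).
pose om' y := P' (y - T) - Q' (T - y).
pose r := Num.min rP rQ.
have r0 : 0 < r by rewrite lt_min rP0.
have rrP : r <= rP by rewrite ge_min lexx.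
have rrQ : r <= rQ by rewrite ge_min lexx orbT.
have omD y : is_derive y (1 : R) om (om' y).
  by have H := is_deriveD (is_derive_translate PD (- T) y) (is_derive_mirror QD T y); exact: H.
have om'c : continuous om'.
  move=> y; apply: cvgB.
    by apply: (@continuous_comp _ _ _ (fun y : R => y - T) P');
      [apply: cvgB; [exact: cvg_id|exact: cvg_cst]|exact: P'c].
  by apply: (@continuous_comp _ _ _ (fun y : R => T - y) Q');
    [apply: cvgB; [exact: cvg_cst|exact: cvg_id]|exact: Q'c].
have omS y : `|y - be S| <= r -> om y = 0.
  move=> H; rewrite /om Pz ?Qz ?addr0//; right; right.
    by rewrite (_ : T - y - - k = - (y - be S)) ?normrN ?(le_trans H)// /k; ring.
  by rewrite (_ : y - T - k = y - be S) ?(le_trans H)// /k; ring.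
have omT y : be T - r <= y -> om y = 0.
  rewrite /char_right => H; rewrite /om Pz ?Qz ?addr0//; [left|right; left]; lra.
have om_al t : S < t < T -> om (al t) = 0.
  move=> /andP[St tT].
  have := char_left_increasing l_cont l_deriv l'_lt1 (le_trans S0 (ltW St)) tT.
  rewrite /char_left => H; rewrite /om Pz ?Qz ?addr0//; [right; left|left]; lra.
have [z [z' [zD z'c zr zz]]] :=
  reflection l_cont l_deriv l'_cont l'_lt1 gam omD om'c r0 S0 ST omS omT.
pose Th y := om y + z y.
have ThD y : is_derive y (1 : R) Th (om' y + z' y) by exact: is_deriveD (omD y) (zD y).
have Th'c : continuous (fun y => om' y + z' y) by move=> y; apply: cvgD; [exact: om'c|exact: z'c].
have Thr t : S < t < T -> Th (al t) = gam * Th (be t).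
  move=> tST; have /andP[St tT] := tST.
  (* At [al t] only z contributes, because al t < al T; at [be t] only om does, because be t > be S
     >= al T. *)
  rewrite /Th om_al// (zr t); last by rewrite !ltW.
  rewrite (zz (be t)) ?addr0 ?add0r// negb_and -!leNgt; apply/orP; right.
  apply: (le_trans aTbS); apply: ltW.
  exact: (char_right_increasing l_cont l_deriv l'_lt1 S0 St).
have K := energy_le_mismatch eta0 l_cont l_pos l_deriv l'_cont uV uC uW ThD Th'c S0 ST Thr slow.
apply: (le_trans K).
(* At time T the reflected part lies outside (al T, be T), so the mismatch is just the approximation
   error of P and Q. *)
rewrite lerD2l /mismatch (splitr e); apply: lerD.
- apply: le_trans Pe; rewrite le_eqVlt; apply/orP; left; apply/eqP.
  apply: eq_Rintegral => x; rewrite inE/= in_itv/= => /andP[x0 xl].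
  rewrite /Th /om zz; last by rewrite negb_and -!leNgt /char_left; apply/orP; right; lra.
  rewrite (_ : T + x - T = x); last by ring.
  by rewrite Qz ?addr0//; left; lra.
- apply: le_trans Qe; rewrite le_eqVlt; apply/orP; left; apply/eqP.
  apply: eq_Rintegral => x; rewrite inE/= in_itv/= => /andP[x0 xl].
  rewrite /Th /om zz; last by rewrite negb_and -!leNgt /char_left; apply/orP; right; lra.
  rewrite (_ : T - (T - x) = x); last by ring.
  by rewrite Pz ?add0r ?addr0//; left; lra.
Qed.

Lemma energy_nonincreasing S T : 0 <= S -> S <= T ->
  (forall t, S <= t <= T -> gam ^+ 2 * (1 - l' t) <= 1 + l' t) ->
  energy l ux ut T <= energy l ux ut S.
Proof.
move=> S0 ST slow.
have lc : {within `[S, T], continuous l}.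
  by apply: continuous_subspaceW l_cont; apply: subset_itv; rewrite bnd_simp.
have [c cST lmin] := EVT_min ST lc.
have c0 : 0 <= c by move: cST; rewrite in_itv/= => /andP[Sc _]; exact: le_trans Sc.
(* The minimum of l is an admissible step length: q - p <= lam <= l p + l q gives al q <= be p. *)
have lam0 := l_pos c0; set lam := l c in lmin lam0.
have steps n : forall a b, S <= a -> a <= b -> b <= T -> b - a <= n%:R * lam ->
    energy l ux ut b <= energy l ux ut a.
  elim: n => [|n IH] a b Sa ab bT.
    rewrite mul0r subr_le0 => ba.
    by have -> : a = b by apply/eqP; rewrite eq_le ab.
  move=> H; move: ab; rewrite le_eqVlt => /predU1P[->//|ab].
  have st p q : S <= p -> p < q -> q <= T -> q - p <= lam -> energy l ux ut q <= energy l ux ut p.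
    move=> Sp pq qT pql; apply: energy_step => //; first exact: le_trans Sp.
      have := lmin p; rewrite in_itv/= Sp (le_trans (ltW pq) qT) => /(_ isT).
      have := lmin q; rewrite in_itv/= qT (le_trans Sp (ltW pq)) => /(_ isT).
      rewrite /char_left /char_right; lra.
    move=> t /andP[pt tq]; apply: slow; apply/andP; split.
      exact: le_trans Sp (ltW pt).
    exact: le_trans (ltW tq) qT.
  have [small|big] := leP (b - a) lam; first exact: st.
  apply: (@le_trans _ _ (energy l ux ut (a + lam))).
    apply: IH => //; [lra|lra|].
    by move: H; rewrite -natr1; lra.
  apply: st => //; lra.
have := archi_boundP (divr_ge0 (_ : 0 <= T - S) (ltW lam0)); rewrite subr_ge0 => /(_ ST).
rewrite ltr_pdivrMr// => /ltW H.
exact: steps H.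
Qed.

End energy_monotone.

(** * Continuity of the boundary speed *)

Section boundary_speed.
Context {R : realType}.
Variables (l l' phi phi' : R -> R).
Hypothesis l_cont : {within `[0, +oo[, continuous l}.
Hypothesis l_deriv : has_deriv_on `[0, +oo[ l l'.
Hypothesis l'_lt1 : forall t, 0 <= t -> `|l' t| < 1.
Hypothesis l_pos : forall t, 0 <= t -> 0 < l t.
Hypothesis phi_C1 : C1_on `[- l 0, +oo[ phi phi'.
Hypothesis phi'_pos : forall s, - l 0 <= s -> 0 < phi' s.
Hypothesis phi_l : forall t, 0 <= t -> phi (t + l t) - phi (t - l t) = 2.
Implicit Types s t : R.

Let al_ge t : 0 <= t -> - l 0 <= char_left l t.
Proof.
rewrite le_eqVlt => /predU1P[<-|t0]; first by rewrite /char_left sub0r.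
by have /ltW := char_left_increasing l_cont l_deriv l'_lt1 (lexx 0) t0; rewrite {1}/char_left sub0r.
Qed.

Let be_ge t : 0 <= t -> - l 0 <= char_right l t.
Proof.
by move=> t0; rewrite (le_trans (al_ge t0))// /char_left /char_right; have := l_pos t0; lra.
Qed.

Let speed t := (phi' (char_left l t) - phi' (char_right l t)) /
  (phi' (char_left l t) + phi' (char_right l t)).

(* Differentiating phi (t + l t) - phi (t - l t) = 2. *)
Let l'E t : 0 < t -> l' t = speed t.
Proof.
move=> t0; have [phiD _] := phi_C1.
have dphi y : - l 0 < y -> is_derive y (1 : R) phi (phi' y).
  move=> y0; apply: has_deriv_on_is_derive phiD.
  by apply: filterS (lt_nbhsr y0) => x x0; rewrite /= in_itv/= andbT ltW.
have al0 : - l 0 < char_left l t.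
  by have := char_left_increasing l_cont l_deriv l'_lt1 (lexx 0) t0; rewrite {1}/char_left sub0r.
have be0 : - l 0 < char_right l t by rewrite (lt_trans al0)// /char_left /char_right; have := l_pos (ltW t0); lra.
have d1 := @is_derive1_comp _ phi (char_right l) t _ _ (dphi _ be0) (char_right_is_derive l_deriv t0).
have d2 := @is_derive1_comp _ phi (char_left l) t _ _ (dphi _ al0) (char_left_is_derive l_deriv t0).
have d3 := is_deriveB d1 d2.
have d4 : is_derive t (1 : R) (fun x => phi (char_right l x) - phi (char_left l x)) 0.
  have := is_derive_cst (2 : R) t (1 : R); apply: is_derive_near_eq.
  apply: filterS (lt_nbhsr t0) => x x0.
  by rewrite /char_right /char_left phi_l// ltW.
have E : phi' (char_right l t) * (1 + l' t) - phi' (char_left l t) * (1 - l' t) = 0.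
  by case: d3 => _ <-; case: d4.
have p1 := phi'_pos (ltW al0); have p2 := phi'_pos (ltW be0).
have n0 : phi' (char_left l t) + phi' (char_right l t) != 0 by rewrite gt_eqF// addr_gt0.
apply: (mulIf n0); rewrite /speed divfK//; lra.
Qed.

Local Notation future s := (within (`[0, +oo[%classic : set R) (nbhs s)).

(** [phi'] is continuous only within [- l 0, +oo[, and [char_left] starts at the end point - l 0, so
    the composition must remain within that domain. *)
Let phi'_comp (f : R -> R) s : {within `[0, +oo[, continuous f} ->
  (forall t, 0 <= t -> - l 0 <= f t) -> 0 <= s ->
  phi' (f t) @[t --> future s] --> phi' (f s).
Proof.
move=> fc fge s0; apply/cvgrPdist_le => e e0.
have [_ phi'c] := phi_C1.
have := proj1 (within_continuousP _ _) phi'c (f s) _ e e0.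
rewrite /= in_itv/= andbT => /(_ (fge _ s0))/(future_within fc s0) H.
near=> t; have t0 : 0 <= t by near: t; exact: future_ge0.
rewrite distrC; have : f t \in `[- l 0, +oo[ by rewrite in_itv/= andbT fge.
by near: t.
Unshelve. all: by end_near. Qed.

Let speed_cont : {within `[0, +oo[, continuous speed}.
Proof.
apply: within_future => s s0.
have c1 := phi'_comp (char_left_within l_cont) al_ge s0.
have c2 := phi'_comp (char_right_within l_cont) be_ge s0.
apply: cvgM; first exact: cvgB.
apply: cvgV; last exact: cvgD.
by rewrite gt_eqF// addr_gt0// phi'_pos ?al_ge ?be_ge.
Qed.

(* At t = 0 the one-sided derivative is the limit of l' by the mean value
   theorem. *)
Let l'0E : l' 0 = speed 0.
Proof.
apply/eqP; rewrite -subr_eq0 -normr_eq0; apply/eqP/le_anti; rewrite normr_ge0 andbT.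
apply/ler_addgt0Pr => e e0; rewrite add0r.
have e2 : 0 < e / 2 by rewrite divr_gt0.
have z0 : `[0, +oo[%classic (0 : R) by rewrite /= in_itv/= lexx.
have /nbhs_ballP[d1 /= d10 H1] := has_deriv_onP z0 l_deriv e2.
have /nbhs_ballP[d2 /= d20 H2] := proj1 (within_continuousP _ _) speed_cont 0 z0 _ e2.
pose t := Num.min d1 d2 / 2.
have t0 : 0 < t by rewrite divr_gt0// lt_min d10.
have td1 : t < d1.
  have : Num.min d1 d2 <= d1 by rewrite ge_min lexx.
  by rewrite /t; lra.
have td2 : t < d2.
  have : Num.min d1 d2 <= d2 by rewrite ge_min lexx orbT.
  by rewrite /t; lra.
have [||c] := @MVT _ l l' 0 t t0.
- by move=> x; rewrite in_itv/= => /andP[x0 _]; exact: l_is_derive.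
- by apply: continuous_subspaceW l_cont; apply: subset_itv; rewrite bnd_simp.
rewrite in_itv/= subr0 => /andP[c0 ct] E.
have := H1 t; rewrite /ball/= sub0r normrN gtr0_norm// in_itv/= andbT (ltW t0) => /(_ td1 isT).
rewrite E subr0 -mulrBl normrM (gtr0_norm t0) ler_pM2r// => A1.
have := H2 c; rewrite /ball/= sub0r normrN gtr0_norm// in_itv/= andbT (ltW c0).
rewrite -(l'E c0) => /(_ (lt_trans ct td2) isT) A2.
by move: A1 A2; rewrite !ler_norml => /andP[? ?] /andP[? ?]; apply/andP; split; lra.
Qed.

(** [l'] coincides on [0, +oo[ with a quotient built from phi' along the two characteristics.
    Continuity is used for the boundary flux, for the C^1 regularity of the reflected weight and for
    the minimum of l'. *)
Lemma boundary_speed_continuous : {within `[0, +oo[, continuous l'}.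
Proof.
have E t : 0 <= t -> l' t = speed t.
  by rewrite le_eqVlt => /predU1P[<-|/l'E//]; exact: l'0E.
apply/within_continuousP => s; rewrite /= in_itv/= andbT => s0 e e0.
have := proj1 (within_continuousP _ _) speed_cont s _ e e0.
rewrite /= in_itv/= andbT => /(_ s0); apply: filterS => t Ht tD.
by have := tD; rewrite in_itv/= andbT => t0; rewrite !E//; exact: Ht.
Qed.

End boundary_speed.

Lemma reflection_coef_lt1 (R : realType) (eta : R) : 0 < eta ->
  reflection_coef eta ^+ 2 < 1.
Proof.
move=> eta0; have e1 : 0 < eta + 1 by rewrite addr_gt0.
by rewrite /reflection_coef expr_div_n ltr_pdivrMr ?exprn_gt0// mul1r; nra.
Qed.

(** Since eta + 1 > 1, the square is at most (eta - 1)^2 <= d^2 <= d. *)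
Lemma reflection_coef_le (R : realType) (eta d : R) : 0 < eta -> `|eta - 1| < d ->
  d <= 1 -> reflection_coef eta ^+ 2 <= d.
Proof.
move=> eta0; rewrite ltr_norml => /andP[? ?] d1.
have e1 : 0 < eta + 1 by rewrite addr_gt0.
rewrite /reflection_coef expr_div_n ler_pdivrMr ?exprn_gt0//.
have d0 : 0 < d by lra.
have : (eta - 1) ^+ 2 <= d ^+ 2 by nra.
have : d ^+ 2 <= d by nra.
have : d * 1 <= d * (eta + 1) ^+ 2 by rewrite ler_pM2l//; nra.
lra.
Qed.

Unset Implicit Arguments.

Theorem mainTheorem7 (R : realType) (l l' phi phi' : R -> R)
  (l_cont : {within `[0, +oo[, continuous l})
  (l_pos : forall t, 0 <= t -> 0 < l t)
  (l_deriv : has_deriv_on `[0, +oo[ l l')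
  (l'_lt1 : forall t, 0 <= t -> `|l' t| < 1)
  (phi_C1 : C1_on `[- l 0, +oo[ phi phi')
  (phi'_pos : forall s, - l 0 <= s -> 0 < phi' s)
  (phi_l : forall t, 0 <= t -> phi (t + l t) - phi (t - l t) = 2) :
  (forall t1 t2 : R, 0 <= t1 -> t1 < t2 ->
     (forall t, t1 <= t <= t2 -> 0 < l' t < 1) ->
     forall eta : R, 0 < eta -> eta != 1 ->
     forall (u0 u0' u1 : R -> R) (u ux ut : R -> R -> R),
       V0 (l 0) u0 u0' -> L2 `]0, l 0[ u1 ->
       is_solution eta l l' u0 u1 u ux ut ->
       nonincreasing_on `[t1, t2] (energy l ux ut))
  /\
  (forall t1 t2 : R, 0 <= t1 -> t1 < t2 ->
     (forall t, t1 <= t <= t2 -> -1 < l' t < 0) ->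
     exists2 delta : R, 0 < delta &
       forall eta : R, 0 < eta -> eta != 1 -> `|eta - 1| < delta ->
       forall (u0 u0' u1 : R -> R) (u ux ut : R -> R -> R),
         V0 (l 0) u0 u0' -> L2 `]0, l 0[ u1 ->
         is_solution eta l l' u0 u1 u ux ut ->
         nonincreasing_on `[t1, t2] (energy l ux ut)).
Proof.
have l'_cont := boundary_speed_continuous l_cont l_deriv l'_lt1 l_pos phi_C1 phi'_pos phi_l.
have decay (eta t1 t2 : R) u0 u1 u ux ut : 0 < eta -> 0 <= t1 ->
    is_solution eta l l' u0 u1 u ux ut ->
    (forall t, t1 <= t <= t2 -> reflection_coef eta ^+ 2 * (1 - l' t) <= 1 + l' t) ->
    nonincreasing_on `[t1, t2] (energy l ux ut).
  move=> eta0 t10 [uV uC uW _ _] slow s t; rewrite /= !in_itv/= => /andP[s1 _] /andP[_ t2t] st.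
  apply: (energy_nonincreasing eta0 l_cont l_pos l_deriv l'_cont l'_lt1 uV uC uW _ st).
    exact: le_trans s1.
  move=> r /andP[sr rt]; apply: slow; apply/andP; split.
    exact: le_trans sr.
  exact: le_trans t2t.
split=> t1 t2 t10 t12 l't.
  move=> eta eta0 _ u0 u0' u1 u ux ut _ _ sol; apply: decay sol _ => // t /l't /andP[? ?].
  (* Here 0 < 1 - l' < 1 < 1 + l', and the squared coefficient is below 1 for every eta > 0. *)
  by have := reflection_coef_lt1 eta0; nra.
have lc : {within `[t1, t2], continuous l'}.
  by apply: continuous_subspaceW l'_cont; apply: subset_itv; rewrite bnd_simp.
(* Compactness turns the pointwise bound l' > -1 into a uniform one, which lets delta depend on the
   interval alone. *)
have [c ct lmin] := EVT_min (ltW t12) lc.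
have c0 : 0 <= c by move: ct; rewrite in_itv/= => /andP[? _]; exact: le_trans t10 _.
have m0 : 0 < 1 + l' c by have := l'_lt1 c c0; rewrite ltr_norml => /andP[? _]; lra.
(* The squared coefficient is at most delta and 1 - l' < 2, so the product is at most 1 + l' c <= 1
   + l' t. *)
exists (Num.min 1 ((1 + l' c) / 2)); first by rewrite lt_min ltr01 divr_gt0.
move=> eta eta0 _ etad u0 u0' u1 u ux ut _ _ sol; apply: decay sol _ => // t tt.
have := reflection_coef_le eta0 etad; rewrite ge_min lexx => /(_ isT) G.
have dm : Num.min 1 ((1 + l' c) / 2) <= (1 + l' c) / 2 by rewrite ge_min lexx orbT.
have := lmin t; rewrite in_itv/= => /(_ tt) H; have /andP[? ?] := l't t tt.
have := sqr_ge0 (reflection_coef eta); nra.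
Qed.
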